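(* For semi-density matrices $\sigma$ and $\rho$ on $n$ qubits, relativized to an elementary unitary transform $A$, $\mathbf{I}(A\sigma A^*:\rho)=^{+}\mathbf{I}(\sigma:\rho)$.
   Context: $U$ is a fixed universal prefix Turing machine and $\mathbf{m}(x/y)=\sum_p 2^{-\|p\|}[U_y(p)=x]$ the universal probability. An object is elementary if its entries have rational real and imaginary parts. A program $q$ lower computes a positive semidefinite matrix $\sigma$ if $U(q)$ outputs an increasing sequence of elementary semi-density matrices converging to $\sigma$; $\underline{\mathbf{m}}(\sigma/x)=\sum\{\mathbf{m}(q/x): q\text{ lower computes }\sigma\}$. The universal semi-density matrix on $n$ qubits is $\boldsymbol{\mu}=\sum_{\text{elementary }|\phi\rangle}\mathbf{m}(|\phi\rangle/n)|\phi\rangle\langle\phi|$. Let $\mathcal{C}_{C\otimes D}$ be the set of lower computable matrices $A\otimes B$ with $\mathrm{Tr}(A\otimes B)(C\otimes D)\le1$, $\mathfrak{C}_{C\otimes D}=\sum_{A\otimes B\in\mathcal{C}_{C\otimes D}}\underline{\mathbf{m}}(A\otimes B/n)A\otimes B$, and $\mathbf{I}(\sigma:\rho)=\log\mathrm{Tr}\,\mathfrak{C}_{\boldsymbol{\mu}\otimes\boldsymbol{\mu}}(\sigma\otimes\rho)$. ''Relativized to $A$'' means $U$ receives an encoding of $A$ on an auxiliary tape. $=^{+}$ denotes equality up to an additive $O(1)$. *)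

(* Defs.v *)
From mathcomp Require Import all_boot all_order all_algebra.
From mathcomp Require Import complex character.
From mathcomp Require Import all_classical all_reals all_analysis.
Set Implicit Arguments.
Unset Strict Implicit.
Unset Printing Implicit Defensive.
Import Order.TTheory GRing.Theory Num.Theory.
Import numFieldNormedType.Exports.
Local Open Scope classical_set_scope.
Local Open Scope ring_scope.
Local Open Scope complex_scope.

(* The conditional argument y of U_y(p) and the object A to which everything
   is relativized are given on two separate tapes. *)
Inductive input_tape := Program | Condition | Auxiliary.

Inductive move := MoveL | MoveR | Stay.

(* Deterministic multitape Turing machine over the tape alphabet
   {0, 1, blank} = option bool. In state q, reading one symbol on each tape,
   it halts (None) or changes state, writes a symbol and moves the head on
   each tape, and possibly appends one bit to its one-way, write-only output
   tape. *)
Record machine := Machine {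
  state : finType;
  work : finType;
  start : state;
  delta : state -> (input_tape + work -> option bool) ->
    option (state * (input_tape + work -> option bool * move) * option bool)
}.

Notation tape_id M := (input_tape + work M)%type.

(* Two-way infinite tape, blank beyond the two lists: [leftward] lists the
   cells to the left of the head, nearest first; [rightward] starts with the
   scanned cell. *)
Record tape := Tape { leftward : seq (option bool);
                      rightward : seq (option bool) }.

Definition scan (t : tape) : option bool := head None (rightward t).

Definition act (t : tape) (sm : option bool * move) : tape :=
  let: Tape l r := t in
  let: (s, m) := sm in
  match m with
  | MoveL => Tape (behead l) [:: head None l, s & behead r]
  | MoveR => Tape (s :: l) (behead r)
  | Stay => Tape l (s :: behead r)
  end.

Definition tape_of (w : seq bool) : tape := Tape [::] (map Some w).

Section Runs.
Variable M : machine.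

Record config := Config {
  cstate : state M;
  ctape : tape_id M -> tape;
  cout : seq bool
}.

Definition init (a y p : seq bool) : config :=
  Config (start M)
    (fun i => match i with
              | inl Program => tape_of p
              | inl Condition => tape_of y
              | inl Auxiliary => tape_of a
              | inr _ => tape_of [::]
              end) [::].

Definition step (c : config) : option config :=
  if delta (cstate c) (fun i => scan (ctape c i)) is Some (q, w, o) then
    Some (Config q (fun i => act (ctape c i) (w i))
                 (if o is Some b then rcons (cout c) b else cout c))
  else None.

Definition run (a y p : seq bool) (t : nat) : config :=
  iter t (fun c => odflt c (step c)) (init a y p).

(* M_y(p) = x relative to a: the machine halts with output x. *)
Definition computes (a y p x : seq bool) : Prop :=
  exists t, step (run a y p t) = None /\ cout (run a y p t) = x.

(* w is an initial segment of the (finite or infinite) output, whether or not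
   the machine halts. *)
Definition emits (a y p w : seq bool) : Prop :=
  exists t, prefix w (cout (run a y p t)).

Definition prefix_machine : Prop :=
  forall a y p s x x', s <> [::] ->
    computes a y p x -> ~ computes a y (p ++ s) x'.

End Runs.

(* Simulation includes the output of nonhalting runs, which is what lower
   computation refers to. *)
Definition universal_prefix_machine (U : machine) : Prop :=
  prefix_machine U /\
  forall T : machine, prefix_machine T ->
    exists t : seq bool, forall a y p w : seq bool,
      (computes T a y p w <-> computes U a y (t ++ p) w) /\
      (emits T a y p w <-> emits U a y (t ++ p) w).

(* An elementary matrix is a matrix over rat[i]; [elem] is its image in the
   complex matrices. *)
Definition elem (R : realType) (m n : nat) (A : 'M[rat[i]]_(m, n)) :
    'M[R[i]]_(m, n) :=
  \matrix_(i, j) (ratr (complex.Re (A i j)) +i* ratr (complex.Im (A i j))).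

(* All codes are self-delimiting. *)
Definition enc_nat (n : nat) : seq bool := rcons (nseq n true) false.

Definition enc_int (z : int) : seq bool :=
  match z with
  | Posz n => true :: enc_nat n
  | Negz n => false :: enc_nat n
  end.

Definition enc_rat (x : rat) : seq bool := enc_int (numq x) ++ enc_int (denq x).

Definition enc_cplx (z : rat[i]) : seq bool :=
  enc_rat (complex.Re z) ++ enc_rat (complex.Im z).

Definition enc_mx (m n : nat) (A : 'M[rat[i]]_(m, n)) : seq bool :=
  enc_nat m ++ enc_nat n ++
  flatten [seq enc_cplx (A i j) | i <- enum 'I_m, j <- enum 'I_n].

(* On R[i], 0 <= z means that z is real and nonnegative, so psd matrices are
   Hermitian. *)
Definition psd (R : realType) (d : nat) (M : 'M[R[i]]_d) : Prop :=
  forall v : 'cV[R[i]]_d, 0 <= ((v ^t* *m M *m v)%sesqui ord0 ord0).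

Definition semi_density (R : realType) (d : nat) (M : 'M[R[i]]_d) : Prop :=
  psd M /\ \tr M <= 1.

Definition mx_cvg (R : realType) (d : nat) (s : nat -> 'M[R[i]]_d)
    (M : 'M[R[i]]_d) : Prop :=
  forall i j,
    (fun k => complex.Re (s k i j)) @ \oo --> complex.Re (M i j) /\
    (fun k => complex.Im (s k i j)) @ \oo --> complex.Im (M i j).

(* Meaningful for absolutely summable families, as are all those below. *)
Definition rsum (R : realType) (T : choiceType) (D : set T) (f : T -> R) : R :=
  fine (\esum_(x in D) ((fun z => (f z)%:E)^\+ x)%E) -
  fine (\esum_(x in D) ((fun z => (f z)%:E)^\- x)%E).

Definition mx_sum (R : realType) (T : choiceType) (d : nat) (D : set T)
    (F : T -> 'M[R[i]]_d) : 'M[R[i]]_d :=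
  \matrix_(i, j) (rsum D (fun x => complex.Re (F x i j)) +i*
                  rsum D (fun x => complex.Im (F x i j))).

(* The argument a of every notion below is the content of the auxiliary tape,
   i.e. the notion is relativized to a. *)

Section Info.
Variables (R : realType) (U : machine) (a : seq bool).

(* The universal probability m(x/y). *)
Definition univ_prob (x y : seq bool) : \bar R :=
  \esum_(p in [set p | computes U a y p x]) ((2^-1 : R) ^+ size p)%:E.

(* Codes are nonempty, so emitting all these initial segments means that the
   output of U(q) is exactly the infinite concatenation of the codes. *)
Definition outputs_seq (d : nat) (q : seq bool) (s : nat -> 'M[rat[i]]_d) :
    Prop :=
  forall k, emits U a [::] q (flatten [seq enc_mx (s i) | i <- iota 0 k]).

Definition lower_computes (d : nat) (q : seq bool) (M : 'M[R[i]]_d) : Prop :=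
  psd M /\
  exists s : nat -> 'M[rat[i]]_d,
    [/\ outputs_seq q s,
        forall k, semi_density (elem R (s k)),
        forall k, psd (elem R (s k.+1) - elem R (s k))
      & mx_cvg (fun k => elem R (s k)) M].

Definition lower_prob (d : nat) (M : 'M[R[i]]_d) (x : seq bool) : \bar R :=
  \esum_(q in [set q | lower_computes q M]) univ_prob q x.

Variable n : nat.

Local Notation N := (2 ^ n)%N.

Definition elementary_states : set 'cV[rat[i]]_N :=
  [set phi | (elem R phi) ^t*%sesqui *m elem R phi = 1%:M].

(* The matrix mu. *)
Definition univ_semi_density : 'M[R[i]]_N :=
  mx_sum elementary_states (fun phi =>
    (fine (univ_prob (enc_mx phi) (enc_nat n)))%:C *:
      (elem R phi *m (elem R phi) ^t*%sesqui)).

Definition tests (C D : 'M[R[i]]_N) : set 'M[R[i]]_(N * N) :=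
  [set M | [/\ exists A B : 'M[R[i]]_N, M = tprod A B,
               exists q, lower_computes q M
             & \tr (M *m tprod C D) <= 1]].

(* The matrix written with a fraktur C, indexed by C (x) D. *)
Definition univ_test (C D : 'M[R[i]]_N) : 'M[R[i]]_(N * N) :=
  mx_sum (tests C D) (fun M => (fine (lower_prob M (enc_nat n)))%:C *: M).

Definition log2 (x : \bar R) : \bar R := (lne x * (ln 2)^-1%:E)%E.

(* I(sigma : rho); -oo when the trace vanishes. *)
Definition info (sigma rho : 'M[R[i]]_N) : \bar R :=
  log2 (complex.Re (\tr (univ_test univ_semi_density univ_semi_density
                         *m tprod sigma rho)))%:E.

End Info.

(* Main.v *)
(** Lower computation only involves semi-density matrices, so a lower computable
    [M] has trace at most 1 and the test condition on [mu (x) mu], also of trace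
    at most 1, is automatic. Let [B = A (x) 1] (or its adjoint). Then
    [M |-> B^* M B] is an injection of the set of tests into itself which moves
    [A sigma A^*] to [sigma] under the trace. It costs only a constant factor in
    probability: a machine that simulates [U] and rewrites the emitted matrices
    one by one, reading [A] from the auxiliary tape, turns every program [q] for
    [M] into the program [t ++ q] for [B^* M B], where [t] does not depend on
    [A]; another machine turns programs that print [q] into programs that print
    [t ++ q].

    The rewriting is a primitive recursive function of the codes. Primitive
    recursive functions are compiled to counter programs, and these to machines
    that keep the counters on work tapes next to the tapes of [U]. *)

Require Import Defs.
From mathcomp Require Import all_boot all_order all_algebra.
From mathcomp Require Import complex character.
From mathcomp Require Import all_classical all_reals all_analysis.
From mathcomp Require Import zify ring lra.
Set Implicit Arguments.
Unset Strict Implicit.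
Unset Printing Implicit Defensive.
Import Order.TTheory GRing.Theory Num.Theory.
Import numFieldNormedType.Exports.

(** * Counter machines simulating U *)

(** The constant may depend neither on [n] nor on [A], so a single machine has to serve all of them.
    It finds [A] on the auxiliary tape, which [U] reads as well, and must therefore bring that head
    back before the simulation begins. The output to be rewritten is infinite, so the rewriting is
    on line: one primitive recursive state update per bit emitted by [U], with output as soon as the
    code of a matrix is complete. Such a machine never halts; it is vacuously a prefix machine, and
    universality applies to it through the clause on [emits]. The machine that prints [t ++ q] does
    halt, and inherits prefix-freeness from [U]. The auxiliary word codes [A] in both inequalities,
    so the reverse one needs a second machine that forms the adjoint itself. All sums of the
    statement go through [fine]; they can be manipulated only once Kraft's inequality and the unique
    decodability of codes have bounded the total weights by 1. *)

Definition tape_eq (t t' : tape) : Prop :=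
  nth None (leftward t) =1 nth None (leftward t') /\
  nth None (rightward t) =1 nth None (rightward t').

Lemma tape_eq_refl t : tape_eq t t. Proof. by []. Qed.

Lemma tape_eq_trans t2 t1 t3 : tape_eq t1 t2 -> tape_eq t2 t3 -> tape_eq t1 t3.
Proof.
by move=> [l1 r1] [l2 r2]; split=> i; [rewrite l1 l2 | rewrite r1 r2].
Qed.

Lemma tape_eq_scan t t' : tape_eq t t' -> scan t = scan t'.
Proof. by case=> _ /(_ 0); rewrite !nth0. Qed.

Lemma tape_eq_act t t' sm : tape_eq t t' -> tape_eq (act t sm) (act t' sm).
Proof.
case: t t' sm => [l r] [l' r'] [s []] /= [/= el er]; split=> [] [|i] //=;
  rewrite -?nth0 ?nth_behead //; try by rewrite el.
by case: i => [|i] //=; rewrite !nth_behead.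
Qed.

(** On an exhausted list of cells, writing back the scanned symbol stores an explicit blank. This is
    why tapes are compared only up to trailing blanks. *)
Lemma tape_eq_stay t : tape_eq (act t (scan t, Stay)) t.
Proof. by case: t => l [|x r]; split=> //= -[|[]]. Qed.

Definition upd (s : nat -> nat) r v : nat -> nat :=
  fun j => if j == r then v else s j.

(* A counter of value [v]: the only nonblank cell is a marker at distance [v]
   to the left of the head. *)
Definition counter (t : tape) (v : nat) : Prop :=
  (forall i, nth None (leftward t) i = if i.+1 == v then Some true else None) /\
  (forall i, nth None (rightward t) i =
     if (v == 0) && (i == 0) then Some true else None).

Lemma counter_scan t v : counter t v -> (scan t == Some true) = (v == 0).
Proof. by case=> _ /(_ 0); rewrite nth0 andbT /scan => ->; case: (v == 0). Qed.

Lemma counter_inc t v : counter t v -> counter (act t (scan t, MoveR)) v.+1.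
Proof.
case: t => l r [/= cl cr]; split=> /= i; last by rewrite nth_behead cr andbF.
by case: i => [|i] /=; [rewrite /scan -nth0 /= cr andbT;
  case: v {cl cr} | rewrite cl].
Qed.

Lemma counter_dec t v : counter t v.+1 -> counter (act t (scan t, MoveL)) v.
Proof.
case: t => l r [/= cl cr]; split=> /= i; first by rewrite nth_behead cl.
by case: i => [|[|i]] /=; rewrite /scan -?nth0 ?nth_behead /= ?cl ?cr /= ?andbF
  ?andbT //; case: (v).
Qed.

Lemma counter_stay t v : counter t v -> counter (act t (scan t, Stay)) v.
Proof.
move=> [cl cr]; have [el er] := tape_eq_stay t.
by split=> i; rewrite ?el ?er.
Qed.

(** [IInit] places the markers of all counters. [IRead r] performs one step of [U] and is repeated
    at the same address until a bit comes out, which is added to [r]. [IAux r t] adds the scanned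
    auxiliary bit to [r] and moves right, or jumps to [t] on a blank. *)
Inductive instr :=
  | IInit | IInc of nat | IDec of nat | IJz of nat & nat | IJmp of nat
  | IEmit of nat | IRead of nat | IAux of nat & nat | IAuxL.

Definition ireg (i : instr) : nat :=
  match i with
  | IInc r | IDec r | IJz r _ | IEmit r | IRead r | IAux r _ => r
  | _ => 0
  end.

Section CodeMachine.
Variables (U : machine) (code : seq instr).

Local Notation m := (\max_(i < size code) ireg (nth (IJmp 0) code i)).
Local Notation creg := 'I_m.+1.
Local Notation wk := (work U + creg)%type.

Definition emb (i : input_tape + work U) : input_tape + wk :=
  match i with inl j => inl j | inr w => inr (inl w) end.

Definition writes (ua : input_tape + work U -> option bool * move)
    (ra : creg -> option bool * move) (i : input_tape + wk) :=
  match i with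
  | inl j => ua (inl j) | inr (inl w) => ua (inr w) | inr (inr x) => ra x
  end.

(** Every branch yields [Some]: the machine never halts. Once [U] has halted, [IRead] idles at its
    address forever. *)
Definition code_delta (st : 'I_(size code).+1 * state U)
    (sc : input_tape + wk -> option bool) :
    option (('I_(size code).+1 * state U) *
            (input_tape + wk -> option bool * move) * option bool) :=
  let: (pc, q) := st in
  let usc j := sc (emb j) in
  let rsc x := sc (inr (inr x)) in
  let ukeep j := (usc j, Stay) in
  let rkeep x := (rsc x, Stay) in
  let radd r b x := (rsc x, if (val x == r) && b then MoveR else Stay) in
  let rz r := rsc (inord r) == Some true in
  let next : 'I_(size code).+1 := inord pc.+1 in
  Some match nth (IJmp 0) code pc with
  | IInit => ((next, q), writes ukeep (fun=> (Some true, Stay)), None)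
  | IInc r => ((next, q), writes ukeep (radd r true), None)
  | IDec r => ((next, q), writes ukeep (fun x =>
        (rsc x, if (val x == r) && (rsc x != Some true) then MoveL else Stay)),
      None)
  | IJz r t => ((if rz r then inord t else next, q), writes ukeep rkeep, None)
  | IJmp t => ((inord t, q), writes ukeep rkeep, None)
  | IEmit r => ((next, q), writes ukeep rkeep, Some (~~ rz r))
  | IRead r => match delta q usc with
      | None => ((pc, q), writes ukeep rkeep, None)
      | Some (q', w, None) => ((pc, q'), writes w rkeep, None)
      | Some (q', w, Some b) => ((next, q'), writes w (radd r b), None)
      end
  | IAux r t => match usc (inl Auxiliary) with
      | None => ((inord t, q), writes ukeep rkeep, None)
      | Some b => ((next, q), writes (fun j =>
            (usc j, if j is inl Auxiliary then MoveR else Stay)) (radd r b),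
              None)
      end
  | IAuxL => ((next, q), writes (fun j =>
            (usc j, if j is inl Auxiliary then MoveL else Stay)) rkeep, None)
  end.

Definition code_machine : machine :=
  @Machine ('I_(size code).+1 * state U)%type wk (inord 0, start U) code_delta.

(** Prefix-freeness constrains halting runs only, and there are none. *)
Lemma code_machine_prefix : prefix_machine code_machine.
Proof.
move=> a y p s x x' _ [t [+ _]]; rewrite /step.
have h st sc : code_delta st sc <> None by case: st.
by case E: delta => [[[]]|] // _; case: (h _ _ E).
Qed.

(** [aout] is the output of the simulator. The output of the simulated [U] lies inside [aconf] and
    gets out only by way of the registers. *)
Record astate := AState {
  aregs : nat -> nat; aconf : config U; aout : seq bool }.

Definition represents (pc : nat) (st : astate) (c : config code_machine) :
    Prop :=
  [/\ cstate c = (inord pc, cstate (aconf st)),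
      forall j, tape_eq (ctape c (emb j)) (ctape (aconf st) j),
      forall x, counter (ctape c (inr (inr x))) (aregs st (val x))
    & cout c = aout st].

Definition tstep (c : config code_machine) := odflt c (step c).

Definition reaches pc st pc' st' := forall c, represents pc st c ->
  exists k, represents pc' st' (iter k tstep c).

Lemma reaches_refl pc st : reaches pc st pc st.
Proof. by move=> c rc; exists 0. Qed.

Lemma reaches_trans pc2 st2 pc1 st1 pc3 st3 :
  reaches pc1 st1 pc2 st2 -> reaches pc2 st2 pc3 st3 ->
  reaches pc1 st1 pc3 st3.
Proof.
move=> r12 r23 c /r12[k /r23[l rl]]; exists (l + k); rewrite iterD; exact: rl.
Qed.

Definition set_aux (u : config U) (t : tape) : config U :=
  Config (cstate u) (fun i => if i is inl Auxiliary then t else ctape u i)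
    (cout u).

Definition aux (u : config U) : tape := ctape u (inl Auxiliary).

Lemma represents_step pc st c q w o : represents pc st c ->
  code_delta (inord pc, cstate (aconf st)) (fun i => scan (ctape c i)) =
    Some (q, w, o) ->
  tstep c = Config (q : state code_machine) (fun i => act (ctape c i) (w i))
              (if o is Some b then rcons (aout st) b else aout st).
Proof.
by case=> es _ _ eo E; rewrite /tstep /step es [delta _ _]E /= eo.
Qed.

Lemma reach1 pc st pc' st' :
  (forall c, represents pc st c -> represents pc' st' (tstep c)) ->
  reaches pc st pc' st'.
Proof. by move=> h c /h rc; exists 1. Qed.

Section Instr.
Variables (pc : nat) (s : nat -> nat) (u : config U) (o : seq bool).
Hypothesis pc_lt : pc < size code.

Local Notation fetch := (nth (IJmp 0) code pc).

Let pcE : (inord pc : 'I_(size code).+1) = pc :> nat.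
Proof. by rewrite inordK // ltnW. Qed.

Let reg_lt : ireg fetch < m.+1.
Proof. by rewrite ltnS (leq_bigmax (Ordinal pc_lt)). Qed.

Let usame c j : represents pc (AState s u o) c ->
  tape_eq (act (ctape c (emb j)) (scan (ctape c (emb j)), Stay)) (ctape u j).
Proof. by case=> _ h _ _; exact/tape_eq_trans/h/tape_eq_stay. Qed.

Let rsame c x : represents pc (AState s u o) c ->
  counter (act (ctape c (inr (inr x))) (scan (ctape c (inr (inr x))), Stay))
    (s (val x)).
Proof. by case=> _ _ h _; exact: counter_stay. Qed.

Let radd c r (b : bool) x : represents pc (AState s u o) c ->
  counter (act (ctape c (inr (inr x))) (scan (ctape c (inr (inr x))),
     if (val x == r) && b then MoveR else Stay)) (upd s r (s r + b) (val x)).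
Proof.
case=> _ _ /(_ x) h _; rewrite /upd; case: eqP => [<-|_] /=;
  last exact: counter_stay.
by case: b; rewrite ?addn1 ?addn0; [exact: counter_inc | exact: counter_stay].
Qed.

Let rz c : represents pc (AState s u o) c ->
  (scan (ctape c (inr (inr (inord (ireg fetch))))) == Some true)
    = (s (ireg fetch) == 0).
Proof.
by case=> _ _ /(_ (inord (ireg fetch))) h _; rewrite (counter_scan h) /= inordK.
Qed.

Local Ltac start_instr hf rc := 
  apply: reach1 => c rc;
  erewrite represents_step; [|exact: rc|rewrite /code_delta /= pcE hf;
    reflexivity].

Lemma reach_inc r : fetch = IInc r ->
  reaches pc (AState s u o) pc.+1 (AState (upd s r (s r).+1) u o).
Proof.
move=> hf; start_instr hf rc; split=> //= [[j|w]|x].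
- exact: (usame (inl j)). 
- exact: (usame (inr w)).
- by have := radd r true x rc; rewrite addn1.
Qed.

(** A blank work tape represents no counter value at all, so the start needs its own lemma: [IInit]
    writes a marker under each head, which is the value 0. *)
Lemma reach_init : fetch = IInit -> (forall x, s x = 0) -> 
  forall c : config code_machine, cstate c = (inord pc, cstate u) ->
   (forall j, tape_eq (ctape c (emb j)) (ctape u j)) ->
   (forall x, ctape c (inr (inr x)) = tape_of [::]) ->
   cout c = o ->
  represents pc.+1 (AState s u o) (tstep c).
Proof.
move=> hf s0 c es et ec eo; rewrite /tstep /step es /= pcE hf /= eo.
split=> //= [[j|w]|x].
- exact: tape_eq_trans (tape_eq_stay _) (et (inl j)).
- exact: tape_eq_trans (tape_eq_stay _) (et (inr w)).
- by rewrite ec s0; split=> /= -[|[|i]].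
Qed.

Lemma reach_dec r : fetch = IDec r ->
  reaches pc (AState s u o) pc.+1 (AState (upd s r (s r).-1) u o).
Proof.
move=> hf; start_instr hf rc; split=> //= [[j|w]|x].
- exact: (usame (inl j)). 
- exact: (usame (inr w)).
- case: rc => _ _ /(_ x) h _; rewrite (counter_scan h) /= /upd.
  case: eqP => [<-|_] /=; last exact: counter_stay.
  by move: h => /=; case: (s x) => [|v] h;
    [exact: counter_stay | exact: counter_dec].
Qed.

Lemma reach_jz r t : fetch = IJz r t ->
  reaches pc (AState s u o) (if s r == 0 then t else pc.+1) (AState s u o).
Proof.
move=> hf; start_instr hf rc; split=> //= [|[j|w]|x].
- by have := rz rc; rewrite hf /= => ->; case: ifP.
- exact: (usame (inl j)). 
- exact: (usame (inr w)).
- exact: rsame.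
Qed.

Lemma reach_jmp t : fetch = IJmp t ->
  reaches pc (AState s u o) t (AState s u o).
Proof.
move=> hf; start_instr hf rc; split=> //= [[j|w]|x].
- exact: (usame (inl j)). 
- exact: (usame (inr w)).
- exact: rsame.
Qed.

Lemma reach_emit r : fetch = IEmit r ->
  reaches pc (AState s u o) pc.+1 (AState s u (rcons o (s r != 0))).
Proof.
move=> hf; start_instr hf rc; split=> //= [[j|w]|x|].
- exact: (usame (inl j)). 
- exact: (usame (inr w)).
- exact: rsame.
- by have := rz rc; rewrite hf /= => ->.
Qed.

Let uscan c : represents pc (AState s u o) c ->
  (fun j => scan (ctape c (emb j))) = (fun j => scan (ctape u j)).
Proof. by case=> _ h _ _; apply/funext => j; exact: tape_eq_scan. Qed.

Lemma reach_read_silent r u' : fetch = IRead r ->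
  step u = Some u' -> cout u' = cout u ->
  reaches pc (AState s u o) pc (AState s u' o).
Proof.
move=> hf; rewrite /step; case E: delta => [[[q w] ob]|] // [<-] /=.
case: ob E => [b|] E.
  by move=> /(congr1 size) /eqP;
    rewrite size_rcons -[X in _ == X]addn0 -addn1 eqn_add2l.
move=> _; apply: reach1 => c rc.
erewrite represents_step;
  [|exact: rc|by rewrite /code_delta /= pcE hf (uscan rc) E; reflexivity].
case: (rc) => _ h _ _; split=> //= [[j|i]|x].
- exact: (tape_eq_act _ (h (inl j))).
- exact: (tape_eq_act _ (h (inr i))).
- exact: rsame.
Qed.

Lemma reach_read_bit r b u' : fetch = IRead r ->
  step u = Some u' -> cout u' = rcons (cout u) b ->
  reaches pc (AState s u o) pc.+1 (AState (upd s r (s r + b)) u' o).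
Proof.
move=> hf; rewrite /step; case E: delta => [[[q w] ob]|] // [<-] /=.
case: ob E => [b'|] E; last first.
  by move=> /(congr1 size) /eqP;
    rewrite size_rcons -[X in X == _]addn0 -addn1 eqn_add2l.
move=> /rcons_inj[<-]; apply: reach1 => c rc.
erewrite represents_step;
  [|exact: rc|by rewrite /code_delta /= pcE hf (uscan rc) E; reflexivity].
case: (rc) => _ h _ _; split=> //= [[j|i]|x].
- exact: (tape_eq_act _ (h (inl j))).
- exact: (tape_eq_act _ (h (inr i))).
- exact: radd.
Qed.

Lemma reach_aux_blank r t : fetch = IAux r t -> scan (aux u) = None ->
  reaches pc (AState s u o) t (AState s u o).
Proof.
move=> hf e; apply: reach1 => c rc; case: (rc) => _ h _ _.
have e' : scan (ctape c (inl Auxiliary)) = None by rewrite -e;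
  exact/tape_eq_scan/(h (inl Auxiliary)).
erewrite represents_step; [|exact: rc|by rewrite /code_delta /= pcE hf e';
  reflexivity].
split=> //= [[j|w]|x].
- exact: (usame (inl j)). 
- exact: (usame (inr w)).
- exact: rsame.
Qed.

Lemma reach_aux_bit r t b : fetch = IAux r t -> scan (aux u) = Some b ->
  reaches pc (AState s u o) pc.+1
    (AState (upd s r (s r + b)) (set_aux u (act (aux u) (Some b, MoveR))) o).
Proof.
move=> hf e; apply: reach1 => c rc; case: (rc) => _ h _ _.
have e' : scan (ctape c (inl Auxiliary)) = Some b.
  by rewrite -e; exact/tape_eq_scan/(h (inl Auxiliary)).
erewrite represents_step; [|exact: rc|by rewrite /code_delta /= pcE hf e';
  reflexivity].
split=> //= [[j|w]|x].
- case: j => /=; [exact: (usame (inl Program)) | exact: (usame (inl Condition))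
  |].
  by rewrite e'; exact: (tape_eq_act _ (h (inl Auxiliary))).
- exact: (usame (inr w)).
- exact: radd.
Qed.

Lemma reach_auxl : fetch = IAuxL ->
  reaches pc (AState s u o) pc.+1
    (AState s (set_aux u (act (aux u) (scan (aux u), MoveL))) o).
Proof.
move=> hf; apply: reach1 => c rc; case: (rc) => _ h _ _.
erewrite represents_step; [|exact: rc|by rewrite /code_delta /= pcE hf;
  reflexivity].
split=> //= [[j|w]|x].
- case: j => /=; [exact: (usame (inl Program)) | exact: (usame (inl Condition))
  |].
  rewrite (tape_eq_scan (h (inl Auxiliary))).
  exact: (tape_eq_act _ (h (inl Auxiliary))).
- exact: (usame (inr w)).
- exact: rsame.
Qed.

End Instr.
End CodeMachine.

(** * Structured counter programs *)

(** [CIf] takes its first branch on a nonzero register. [CAux r c] is a loop: while the auxiliary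
    head scans a bit, add it to [r], move right and run [c]. *)
Inductive cmd :=
  | CInc of nat | CDec of nat | CSeq of cmd & cmd | CIf of nat & cmd & cmd
  | CWhile of nat & cmd | CEmit of nat | CRead of nat | CAux of nat & cmd
  | CAuxL.

Notation "c1 ;; c2" := (CSeq c1 c2) (at level 60, right associativity).

(** Jump targets are absolute, so code is generated for the address [off] where it will stand. The
    increment by 2 accounts for the test in front and the jump behind. *)
Fixpoint compile (off : nat) (c : cmd) : seq instr :=
  match c with
  | CInc r => [:: IInc r]
  | CDec r => [:: IDec r]
  | c1 ;; c2 => let a := compile off c1 in a ++ compile (off + size a) c2
  | CIf r c1 c2 =>
      let a := compile off.+1 c1 in
      let b := compile (off + (size a).+2) c2 in
      IJz r (off + (size a).+2)
        :: a ++ IJmp (off + (size a).+2 + size b) :: b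
  | CWhile r c =>
      let a := compile off.+1 c in
      IJz r (off + (size a).+2) :: a ++ [:: IJmp off]
  | CEmit r => [:: IEmit r]
  | CRead r => [:: IRead r]
  | CAux r c =>
      let a := compile off.+1 c in
      IAux r (off + (size a).+2) :: a ++ [:: IJmp off]
  | CAuxL => [:: IAuxL]
  end.

Lemma compile_seq off c1 c2 : compile off (c1 ;; c2) =
  compile off c1 ++ compile (off + size (compile off c1)) c2.
Proof. by []. Qed.

Lemma compile_while off r c : compile off (CWhile r c) =
  IJz r (off + (size (compile off.+1 c)).+2) :: compile off.+1 c ++ [:: IJmp
    off].
Proof. by []. Qed.

Section Semantics.
Variable U : machine.

(** Silent steps of [U] followed by the first step that emits a bit. *)
Inductive uread : config U -> bool -> config U -> Prop :=
  | UBit u u' b : step u = Some u' -> cout u' = rcons (cout u) b -> uread u b u'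
  | USilent u u1 u' b : step u = Some u1 -> cout u1 = cout u ->
      uread u1 b u' -> uread u b u'.

Local Notation AState s u o := (@AState U s u o).

(** A big-step semantics, hence restricted to terminating commands; the endless main loop of a
    transducer is treated with [reaches] instead. *)
Inductive exec : cmd -> astate U -> astate U -> Prop :=
  | EInc r s u o : exec (CInc r) (AState s u o) (AState (upd s r (s r).+1) u o)
  | EDec r s u o : exec (CDec r) (AState s u o) (AState (upd s r (s r).-1) u o)
  | ESeq c1 c2 st1 st2 st3 : exec c1 st1 st2 -> exec c2 st2 st3 ->
      exec (c1 ;; c2) st1 st3
  | EIf0 r c1 c2 st st' : aregs st r = 0 -> exec c2 st st' ->
      exec (CIf r c1 c2) st st'
  | EIfS r c1 c2 st st' : aregs st r <> 0 -> exec c1 st st' ->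
      exec (CIf r c1 c2) st st'
  | EWhile0 r c st : aregs st r = 0 -> exec (CWhile r c) st st
  | EWhileS r c st1 st2 st3 : aregs st1 r <> 0 -> exec c st1 st2 ->
      exec (CWhile r c) st2 st3 -> exec (CWhile r c) st1 st3
  | EEmit r s u o :
      exec (CEmit r) (AState s u o) (AState s u (rcons o (s r != 0)))
  | ERead r s u o b u' : uread u b u' ->
      exec (CRead r) (AState s u o) (AState (upd s r (s r + b)) u' o)
  | EAux0 r c s u o : scan (aux u) = None ->
      exec (CAux r c) (AState s u o) (AState s u o)
  | EAuxS r c s u o b st st' : scan (aux u) = Some b ->
      exec c (AState (upd s r (s r + b))
               (set_aux u (act (aux u) (Some b, MoveR))) o) st ->
      exec (CAux r c) st st' -> exec (CAux r c) (AState s u o) st'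
  | EAuxL s u o : exec CAuxL (AState s u o)
      (AState s (set_aux u (act (aux u) (scan (aux u), MoveL))) o).

Section Compile.
Variable code : seq instr.

Definition code_at off cs :=
  exists pre post, code = pre ++ cs ++ post /\ size pre = off.

Lemma code_at_cat off a b : code_at off (a ++ b) ->
  code_at off a /\ code_at (off + size a) b.
Proof.
move=> [pre [post [e <-]]]; split; first by exists pre, (b ++ post);
  rewrite e !catA.
by exists (pre ++ a), post; rewrite e !catA size_cat.
Qed.

Lemma code_at_cons off i cs : code_at off (i :: cs) ->
  [/\ off < size code, nth (IJmp 0) code off = i & code_at off.+1 cs].
Proof.
move=> [pre [post [e <-]]]; split.
- by rewrite e size_cat /= addnS ltnS leq_addr.
- by rewrite e nth_cat ltnn subnn.
- by exists (rcons pre i), post; rewrite e cat_rcons size_rcons.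
Qed.

Lemma reaches_pc pc st pc1 pc2 st' : @reaches U code pc st pc1 st' ->
  pc1 = pc2 -> @reaches U code pc st pc2 st'.
Proof. by move=> + <-. Qed.

(** The induction is on the derivation, not on the command: the remaining iterations of a loop then
    form a smaller derivation for the same code at the same address. *)
Lemma compile_correct c off st st' : exec c st st' ->
  code_at off (compile off c) ->
  @reaches U code off st (off + size (compile off c)) st'.
Proof.
move=> e; elim: e off => {c st st'} /=.
- by move=> r s u o off /code_at_cons[lt f _]; rewrite addn1; exact: reach_inc.
- by move=> r s u o off /code_at_cons[lt f _]; rewrite addn1; exact: reach_dec.
- move=> c1 c2 st1 st2 st3 _ IH1 _ IH2 off /code_at_cat[/IH1 r1 /IH2 r2].
  by apply: reaches_trans r1 _; rewrite size_cat addnA.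
- move=> r c1 c2 [s u o] st' /= s0 _ IH off /code_at_cons[lt f].
  rewrite -cat_rcons => /code_at_cat[_]; rewrite size_rcons addSnnS => /IH r2.
  apply: reaches_trans (reach_jz lt f) _.
  by rewrite s0 /=; apply: reaches_pc r2 _; rewrite size_cat size_rcons; lia.
- move=> r c1 c2 [s u o] st' /= s0 _ IH off /code_at_cons[lt f].
  move=> /code_at_cat[/IH r1]; rewrite addSnnS => /code_at_cons[lt' f' _].
  apply: reaches_trans (reach_jz lt f) _; rewrite (introF eqP s0).
  apply: reaches_trans r1 _; rewrite addSnnS.
  case: st' {IH} => s' u' o'; apply: reaches_pc; first exact: reach_jmp f'.
  by rewrite size_cat /=; lia.
- move=> r c [s u o] /= s0 off /code_at_cons[lt f _].
  have := @reach_jz _ _ _ s u o lt _ _ f; rewrite s0 /=.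
  by rewrite size_cat /= addn1.
- move=> r c [s u o] st2 st3 /= s0 _ IH1 _ IH2 off cat.
  have /code_at_cons[lt f] := cat.
  move=> /code_at_cat[/IH1 r1]; rewrite addSnnS => /code_at_cons[lt' f' _].
  apply: reaches_trans (reach_jz lt f) _; rewrite (introF eqP s0).
  apply: reaches_trans r1 _; rewrite addSnnS.
  apply: (@reaches_trans _ _ off st2); last exact: IH2.
  by case: st2 {IH1 IH2} => s' u' o'; exact: reach_jmp.
- by move=> r s u o off /code_at_cons[lt f _]; rewrite addn1; exact: reach_emit.
- move=> r s u o b u' ur off /code_at_cons[lt f _]; rewrite addn1.
  elim: ur => {u u' b} [u u' b h1 h2|u u1 u' b h1 h2 _ IH];
    first exact: reach_read_bit f h1 h2.
  by apply: reaches_trans IH; exact: reach_read_silent f h1 h2.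
- move=> r c s u o e off /code_at_cons[lt f _]; rewrite size_cat /= addn1.
  exact: reach_aux_blank f e.
- move=> r c s u o b st2 st3 e _ IH1 _ IH2 off cat.
  have /code_at_cons[lt f] := cat.
  move=> /code_at_cat[/IH1 r1]; rewrite addSnnS => /code_at_cons[lt' f' _].
  apply: reaches_trans; first exact: reach_aux_bit f e.
  apply: reaches_trans r1 _; rewrite addSnnS.
  apply: (@reaches_trans _ _ off st2); last exact: IH2.
  by case: st2 {IH1 IH2} => s' u' o'; exact: reach_jmp.
- by move=> s u o off /code_at_cons[lt f _]; rewrite addn1; exact: reach_auxl.
Qed.


End Compile.

Lemma exec_regs_eq c s u o s' s'' u' o' :
  exec c (AState s u o) (AState s' u' o') -> s' =1 s'' ->
  exec c (AState s u o) (AState s'' u' o').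
Proof. by move=> + /funext <-. Qed.

Fixpoint shift k (c : cmd) : cmd :=
  match c with
  | CInc r => CInc (k + r) | CDec r => CDec (k + r)
  | c1 ;; c2 => shift k c1 ;; shift k c2
  | CIf r c1 c2 => CIf (k + r) (shift k c1) (shift k c2)
  | CWhile r c => CWhile (k + r) (shift k c)
  | CEmit r => CEmit (k + r) | CRead r => CRead (k + r)
  | CAux r c => CAux (k + r) (shift k c)
  | CAuxL => CAuxL
  end.

Definition prepend (h : seq nat) (s : nat -> nat) : nat -> nat :=
  fun j => if j < size h then nth 0 h j else s (j - size h).

Definition aprepend h (st : astate U) :=
  AState (prepend h (aregs st)) (aconf st) (aout st).

Lemma prependE h s r : prepend h s (size h + r) = s r.
Proof. by rewrite /prepend ltnNge leq_addr /= addKn. Qed.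

Lemma prepend_upd h s r v :
  prepend h (upd s r v) = upd (prepend h s) (size h + r) v.
Proof.
apply/funext => j; rewrite /prepend /upd; case: ltnP => hj.
  by case: eqP => // e; move: hj; rewrite e ltnNge leq_addr.
by have -> : (j == size h + r) = (j - size h == r) by lia.
Qed.

(** A frame rule: a subroutine written for registers 0, 1, ... runs above the saved values [h] and
    leaves them alone. *)
Lemma exec_shift h c st st' : exec c st st' ->
  exec (shift (size h) c) (aprepend h st) (aprepend h st').
Proof.
elim=> {c st st'} /=; rewrite /aprepend /=.
- by move=> r s u o; rewrite prepend_upd -(prependE h s); exact: EInc.
- by move=> r s u o; rewrite prepend_upd -(prependE h s); exact: EDec.
- by move=> *; apply: ESeq; eassumption.
- by move=> *; apply: EIf0 => //=; rewrite prependE.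
- by move=> *; apply: EIfS => //=; rewrite prependE.
- by move=> *; apply: EWhile0 => //=; rewrite prependE.
- by move=> *; apply: EWhileS => /=; rewrite ?prependE; eassumption.
- by move=> r s u o; rewrite -(prependE h s); exact: EEmit.
- by move=> r s u o b u' ur; rewrite prepend_upd -(prependE h s); exact: ERead.
- by move=> *; apply: EAux0.
- move=> r c s u o b st st' e; rewrite prepend_upd -(prependE h s) => *.
  by apply: EAuxS; eassumption.
- by move=> *; exact: EAuxL.
Qed.

(** Registers beyond the list are 0, so trailing zeros are invisible and fresh scratch registers are
    always at hand. *)
Definition stk (l : seq nat) : nat -> nat := nth 0 l.

Lemma stk_upd l r v : upd (stk l) r v = stk (set_nth 0 l r v).
Proof. by apply/funext => j; rewrite /stk nth_set_nth. Qed.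

Lemma stk_prepend h l : prepend h (stk l) = stk (h ++ l).
Proof. by apply/funext => j; rewrite /stk nth_cat. Qed.

Definition pexec c l l' := forall u o,
  exec c (AState (stk l) u o) (AState (stk l') u o).

Lemma pexec_seq c1 c2 l l1 l2 :
  pexec c1 l l1 -> pexec c2 l1 l2 -> pexec (c1 ;; c2) l l2.
Proof. by move=> e1 e2 u o; exact: ESeq (e1 u o) (e2 u o). Qed.

Lemma pexec_shift h c l l' : pexec c l l' ->
  pexec (shift (size h) c) (h ++ l) (h ++ l').
Proof.
by move=> e u o; have := exec_shift h (e u o);
  rewrite /aprepend /= !stk_prepend.
Qed.

Lemma pexec_inc r l : pexec (CInc r) l (set_nth 0 l r (nth 0 l r).+1).
Proof. by move=> u o; rewrite -stk_upd; exact: EInc. Qed.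

Lemma pexec_dec r l : pexec (CDec r) l (set_nth 0 l r (nth 0 l r).-1).
Proof. by move=> u o; rewrite -stk_upd; exact: EDec. Qed.

Lemma pexec_while0 r c l : nth 0 l r = 0 -> pexec (CWhile r c) l l.
Proof. by move=> e u o; exact: EWhile0. Qed.

Lemma pexec_whileS r c l1 l2 l3 : nth 0 l1 r <> 0 -> pexec c l1 l2 ->
  pexec (CWhile r c) l2 l3 -> pexec (CWhile r c) l1 l3.
Proof. by move=> h e1 e2 u o; exact: EWhileS (e1 u o) (e2 u o). Qed.

Lemma pexec_if0 r c1 c2 l l' : nth 0 l r = 0 -> pexec c2 l l' ->
  pexec (CIf r c1 c2) l l'.
Proof. by move=> h e u o; apply: EIf0. Qed.

Lemma pexec_ifS r c1 c2 l l' : nth 0 l r <> 0 -> pexec c1 l l' ->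
  pexec (CIf r c1 c2) l l'.
Proof. by move=> h e u o; apply: EIfS. Qed.

Lemma pexec_eq c l l1 l2 : stk l1 = stk l2 -> pexec c l l1 -> pexec c l l2.
Proof. by rewrite /pexec => ->. Qed.

(** * Clearing, moving and copying counters *)

Definition cclear i := CWhile i (CDec i).
(** Both [cmove] and [ccopy] add to the target. Copying has to destroy and rebuild its source, by
    means of a scratch register [t] that is 0 before and after. *)
Definition cmove i j := CWhile i (CDec i ;; CInc j).
Definition ccopy i j t := CWhile i (CDec i ;; CInc j ;; CInc t) ;; cmove t i.

Lemma exec_clear i s u o : exec (cclear i) (AState s u o) (AState (upd s i 0) u
  o).
Proof.
move e: (s i) => v; elim: v s e => [|v IH] s e.
  apply: exec_regs_eq (@EWhile0 _ _ (AState s u o) e) _ => j.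
  by rewrite /upd; case: eqP => // ->.
apply: EWhileS; [by rewrite /= e | exact: EDec | ].
have := IH (upd s i (s i).-1); rewrite {1}/upd eqxx e => /(_ erefl) h.
by apply: exec_regs_eq h _ => j; rewrite /upd; case: eqP.
Qed.

Lemma exec_move i j s u o : i <> j ->
  exec (cmove i j) (AState s u o) (AState (upd (upd s i 0) j (s j + s i)) u o).
Proof.
move=> /eqP ij; move e: (s i) => v; elim: v s e => [|v IH] s e.
  apply: exec_regs_eq (@EWhile0 _ _ (AState s u o) e) _ => k.
  by rewrite /upd; case: eqP => [->|_]; rewrite ?addn0 //; case: eqP => // ->.
apply: EWhileS; [by rewrite /= e | apply: ESeq; [exact: EDec | exact: EInc] | ].
set s1 := upd _ _ _; have e1 : s1 i = v.
  by rewrite /s1 /upd (negPf ij) eqxx e.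
have ej : s1 j = (s j).+1 by rewrite /s1 /upd eqxx eq_sym (negPf ij).
have := IH s1 e1; rewrite ej => h; apply: exec_regs_eq h _ => k.
by rewrite /s1 /upd addSnnS; case: (k == j); case: (k == i).
Qed.

Lemma exec_copy i j t s u o : i <> j -> i <> t -> j <> t -> s t = 0 ->
  exec (ccopy i j t) (AState s u o) (AState (upd s j (s j + s i)) u o).
Proof.
move=> /eqP ij /eqP it /eqP jt st0.
apply: (@ESeq _ _ _ (AState (upd (upd (upd s i 0) j (s j + s i)) t (s i)) u o)).
  (* Restated for arbitrary contents of [t], since [t] is no longer 0 after the first iteration of
     the loop. *)
  have -> : upd (upd (upd s i 0) j (s j + s i)) t (s i) =
    upd (upd (upd s i 0) j (s j + s i)) t (s t + s i) by rewrite st0.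
  move=> {st0}.
  move e: (s i) => v; elim: v s e => [|v IH] s e.
    apply: exec_regs_eq (@EWhile0 _ _ (AState s u o) e) _ => k; rewrite /upd.
    by do 3![case: eqP => [->|_]; rewrite ?addn0 //].
  apply: EWhileS; [by rewrite /= e | apply: ESeq; [exact: EDec|] | ].
    apply: ESeq; exact: EInc.
  set s1 := upd _ t _; have e1 : s1 i = v.
    by rewrite /s1 /upd (negPf ij) (negPf it) eqxx e.
  have ej : s1 j = (s j).+1.
    by rewrite /s1 /upd (negPf jt) eqxx eq_sym (negPf ij).
  have et : s1 t = (s t).+1.
    by rewrite /s1 /upd eqxx !(eq_sym t) (negPf jt) (negPf it).
  have := IH s1 e1; rewrite ej et => h; apply: exec_regs_eq h _ => k.
  by rewrite /s1 /upd !addSnnS; case: (k == t); case: (k == j); case: (k == i).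
apply: exec_regs_eq; first by apply: exec_move => /eqP;
  rewrite eq_sym (negPf it).
move=> k; rewrite /upd !eqxx (negPf ij) (negPf it).
by case: eqP => [->|_]; [rewrite (negPf ij) | case: eqP => [->|];
  rewrite // (eq_sym t) (negPf jt)].
Qed.

Lemma pexec_clear i l : pexec (cclear i) l (set_nth 0 l i 0).
Proof. by move=> u o; rewrite -stk_upd; exact: exec_clear. Qed.

Lemma pexec_move i j l : i <> j ->
  pexec (cmove i j) l (set_nth 0 (set_nth 0 l i 0) j (nth 0 l j + nth 0 l i)).
Proof. by move=> ij u o; rewrite -!stk_upd; exact: exec_move. Qed.

Lemma pexec_copy i j t l : i <> j -> i <> t -> j <> t -> nth 0 l t = 0 ->
  pexec (ccopy i j t) l (set_nth 0 l j (nth 0 l j + nth 0 l i)).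
Proof. by move=> ij it jt e u o; rewrite -stk_upd; exact: exec_copy. Qed.

End Semantics.

(** * Primitive recursive functions *)

Fixpoint tri n := if n is m.+1 then n + tri m else 0.

(** Cantor's pairing along the antidiagonals; [tri] gives the triangular numbers. *)
Definition cpair a b := a + tri (a + b).

(** The successor in Cantor's enumeration. Decoding a number is thus plain iteration, which counter
    programs perform without any search. *)
Definition cstep (p : nat * nat) :=
  if p.2 is b.+1 then (p.1.+1, b) else (0, p.1.+1).

Definition unpair n := iter n cstep (0, 0).

Lemma iter_cstep k a b : iter k cstep (a, k + b) = (k + a, b).
Proof.
by elim: k a b => // k IH a b; rewrite iterSr /= /cstep addSn /= IH addnS.
Qed.

Lemma unpair_tri s : unpair (tri s) = (0, s).
Proof.
elim: s => // s IH; rewrite [tri _]/= /unpair addSn iterS iterD -/(unpair _) IH.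
by rewrite -{2}[s]addn0 iter_cstep addn0.
Qed.

Lemma cpairK a b : unpair (cpair a b) = (a, b).
Proof.
by rewrite /unpair iterD -/(unpair _) unpair_tri iter_cstep addn0.
Qed.

Lemma leq_cpairr a b : b <= cpair a b.
Proof.
have h n : n <= tri n by case: n => //= n; exact: leq_addr.
by have := h (a + b); rewrite /cpair; lia.
Qed.

(** Primitive recursive functions in unary form: all arguments are packed by [cpair], so no arities
    occur. The step function of [PRec] receives the parameter, the index and the previous value. *)
Inductive prim :=
  | PZero | PSucc | PLeft | PRight | PPair of prim & prim
  | PComp of prim & prim | PRec of prim & prim.

Fixpoint eval (f : prim) (x : nat) : nat :=
  match f with
  | PZero => 0
  | PSucc => x.+1
  | PLeft => (unpair x).1
  | PRight => (unpair x).2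
  | PPair f g => cpair (eval f x) (eval g x)
  | PComp f g => eval f (eval g x)
  | PRec f g => let: (a, n) := unpair x in
      iteri n (fun i v => eval g (cpair a (cpair i v))) (eval f a)
  end.

(** Register 1 is raised to the sum of both arguments; then its values, counted down to 0, are added
    to register 0, which contributes the triangular number. *)
Definition cmkpair :=
  ccopy 0 1 2 ;; CWhile 1 (ccopy 1 0 2 ;; CDec 1).

Definition cunpair :=
  CWhile 0 (CDec 0 ;; CIf 2 (CDec 2 ;; CInc 1) (CInc 1 ;; cmove 1 2)).

(** Argument and result are in register 0, all other registers being 0 before and after. During
    [PRec], registers 0 to 3 hold the current value, the parameter, the number of rounds left and
    the index; the step function works from register 4 upwards. *)
Fixpoint cprim (f : prim) : cmd :=
  match f with
  | PZero => cclear 0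
  | PSucc => CInc 0
  | PLeft => cunpair ;; cclear 2 ;; cmove 1 0
  | PRight => cunpair ;; cclear 1 ;; cmove 2 0
  | PPair f g => ccopy 0 1 2 ;; shift 1 (cprim f) ;; cmove 0 2 ;;
      shift 2 (cprim g) ;; cmove 1 0 ;; cmove 2 1 ;; cmkpair
  | PComp f g => cprim g ;; cprim f
  | PRec f g =>
      cunpair ;; ccopy 1 3 4 ;; shift 3 (cprim f) ;; cmove 3 0 ;;
      CWhile 2 (CDec 2 ;; cmove 0 6 ;; ccopy 3 5 7 ;; ccopy 1 4 7 ;;
        shift 5 cmkpair ;; shift 4 cmkpair ;; shift 4 (cprim g) ;;
        cmove 4 0 ;; CInc 3) ;;
      cclear 1 ;; cclear 3
  end.

Section CPrim.
Variable U : machine.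
Local Notation pexec := (@pexec U).

Lemma pexec_step c1 c2 l l1 l1' l2 : pexec c1 l l1 -> stk l1 = stk l1' ->
  pexec c2 l1' l2 -> pexec (c1 ;; c2) l l2.
Proof. by move=> e1 /pexec_eq h; apply: pexec_seq; exact: h. Qed.

Lemma stk_cat0 l k : stk (l ++ nseq k 0) = stk l.
Proof.
apply/funext => j; rewrite /stk nth_cat nth_nseq if_same.
by case: ltnP => // h; rewrite nth_default.
Qed.

Lemma pexec_mkpair x y : pexec cmkpair [:: x; y] [:: cpair x y].
Proof.
apply: pexec_step; [exact: pexec_copy | exact: erefl | rewrite /=].
have h a s : pexec (CWhile 1 (ccopy 1 0 2 ;; CDec 1)) [:: a; s] [:: a + tri s;
  0].
  elim: s a => [|s IH] a; first by rewrite addn0; exact: pexec_while0.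
  apply: pexec_whileS => //.
    by apply: pexec_seq; [exact: pexec_copy | exact: pexec_dec].
  by have := IH (a + s.+1); rewrite /= -addnA.
apply: pexec_eq; last exact: h.
by rewrite (stk_cat0 [:: _] 1) [y + x]addnC.
Qed.

Lemma pexec_unpair z :
  pexec cunpair [:: z] [:: 0; (unpair z).1; (unpair z).2].
Proof.
have h n p : pexec cunpair [:: n; p.1; p.2]
    [:: 0; (iter n cstep p).1; (iter n cstep p).2].
  elim: n p => [|n IH] [a b]; first exact: pexec_while0.
  rewrite iterSr; apply: pexec_whileS (IH (cstep (a, b))) => //.
  apply: pexec_step; [exact: pexec_dec | exact: erefl | rewrite /=].
  case: b => [|b].
    apply: pexec_if0 => //; apply: pexec_step;
      [exact: pexec_inc | exact: erefl | ].
    by apply: pexec_eq; last exact: pexec_move.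
  apply: pexec_ifS => //; apply: pexec_step;
    [exact: pexec_dec | exact: erefl | ].
  by apply: pexec_eq; last exact: pexec_inc.
have := h z (0, 0) => /= {}h u o; have := h u o.
by rewrite (stk_cat0 [:: z] 2).
Qed.

Lemma pexec_prim f x : pexec (cprim f) [:: x] [:: eval f x].
Proof.
elim: f x => [||||f IHf g IHg|f IHf g IHg|f IHf g IHg] x /=.
- exact: pexec_clear.
- exact: pexec_inc.
- apply: pexec_seq; first exact: pexec_unpair.
  apply: pexec_seq; first exact: pexec_clear.
  by apply: pexec_eq; last exact: pexec_move; rewrite -(stk_cat0 [:: _] 2).
- apply: pexec_seq; first exact: pexec_unpair.
  apply: pexec_seq; first exact: pexec_clear.
  by apply: pexec_eq; last exact: pexec_move; rewrite -(stk_cat0 [:: _] 2).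
- apply: pexec_seq; first exact: pexec_copy.
  apply: pexec_seq; first exact: (pexec_shift [:: x] (IHf x)).
  apply: pexec_seq; first exact: pexec_move.
  apply: pexec_seq; first exact: (pexec_shift [:: 0; eval f x] (IHg x)).
  apply: pexec_seq; first exact: pexec_move.
  apply: pexec_step; first exact: pexec_move.
    exact: (stk_cat0 [:: eval f x; eval g x] 1).
  exact: pexec_mkpair.
- exact: pexec_seq (IHg x) (IHf _).
- apply: pexec_seq; first exact: pexec_unpair.
  case: (unpair x) => a n /=.
  apply: pexec_seq; first exact: pexec_copy.
  apply: pexec_seq; first exact: (pexec_shift [:: 0; a; n] (IHf a)).
  apply: pexec_seq; first exact: pexec_move.
  rewrite /= add0n; set v0 := eval f a.
  set step := fun i v => eval g (cpair a (cpair i v)).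
  set w := CWhile 2 _.
  have h i k : pexec w [:: iteri i step v0; a; k; i]
      [:: iteri (i + k) step v0; a; 0; i + k].
    elim: k i => [|k IH] i; first by rewrite addn0; exact: pexec_while0.
    rewrite addnS -addSn; apply: pexec_whileS (IH i.+1) => //.
    set v := iteri i _ _.
    apply: pexec_seq; first exact: pexec_dec.
    apply: pexec_seq; first exact: pexec_move.
    apply: pexec_seq; first exact: pexec_copy.
    apply: pexec_seq; first exact: pexec_copy.
    apply: pexec_seq.
      exact: (pexec_shift [:: 0; a; k; i; a] (pexec_mkpair i v)).
    apply: pexec_seq.
      exact: (pexec_shift [:: 0; a; k; i] (pexec_mkpair a (cpair i v))).
    apply: pexec_seq; first exact: (pexec_shift [:: 0; a; k; i] (IHg _)).
    apply: pexec_seq; first exact: pexec_move.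
    apply: pexec_eq; last exact: pexec_inc.
    exact: (stk_cat0 [:: _; a; k; i.+1] 1).
  apply: pexec_seq; first exact: (h 0 n).
  apply: pexec_seq; first exact: pexec_clear.
  apply: pexec_eq; last exact: pexec_clear.
  exact: (stk_cat0 [:: _] 3).
Qed.
End CPrim.

(** * Stream transducers *)

Class encodable (T : Type) := encode : T -> nat.

#[export] Instance encodable_nat : encodable nat := id.
#[export] Instance encodable_bool : encodable bool := nat_of_bool.
#[export] Instance encodable_prod S T {_ : encodable S} {_ : encodable T} :
  encodable (S * T) := fun p => cpair (encode p.1) (encode p.2).
(** Only the empty list has code 0, so a counter program tests emptiness by a single jump. *)
#[export] Instance encodable_seq T {_ : encodable T} : encodable (seq T) :=
  foldr (fun x v => (cpair (encode x) v).+1) 0.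

(** Primitive recursive on codes; the program is constrained only at codes of arguments. Totality of
    [eval] ensures that the update for each bit terminates. *)
Definition computable {S T} {_ : encodable S} {_ : encodable T} (f : S -> T) :=
  exists p, forall x, eval p (encode x) = encode (f x).

(** * Reading the output of [U] bit by bit *)

Section Reading.
Variable U : machine.
Local Notation ustep := (fun c : config U => odflt c (step c)).

Lemma step_cout (u u' : config U) : step u = Some u' ->
  cout u' = cout u \/ exists b, cout u' = rcons (cout u) b.
Proof.
rewrite /step; case: delta => // -[[q w] [b|]] [<-] /=; [right|by left].
by exists b.
Qed.

Lemma run_cout (u : config U) t : exists w, cout (iter t ustep u) = cout u ++ w.
Proof.
elim: t => [|t [w IH]] /=; first by exists [::]; rewrite cats0.
case E: step => [u'|] /=; last by exists w.
have [->|[b ->]] := step_cout E; rewrite IH; first by exists w.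
by exists (rcons w b); rewrite rcons_cat.
Qed.

(** Splits a run at the first bit it emits, as required by an induction on the word still to be
    read. *)
Lemma run_uread (u : config U) t b w : cout (iter t ustep u) = cout u ++ b :: w
  ->
  exists u1 t1, [/\ uread u b u1, cout u1 = rcons (cout u) b
    & cout (iter t1 ustep u1) = cout u1 ++ w].
Proof.
elim: t u => [|t IH] u.
  by move=> /(congr1 size) /eqP; rewrite size_cat -{1}[size _]addn0 eqn_add2l.
rewrite iterSr; case E: (step u) => [u'|] /=; last first.
  have -> : iter t ustep u = u by elim: t {IH} => //= t ->; rewrite E.
  by move=> /(congr1 size) /eqP; rewrite size_cat -{1}[size _]addn0 eqn_add2l.
have [e|[b' e]] := step_cout E.
  rewrite -e => /IH[u1 [t1 [h1 h2 h3]]]; exists u1, t1; split=> //.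
  exact: USilent E e h1.
have [v ev] := run_cout u' t; rewrite ev e cat_rcons => /eqP.
rewrite eqseq_cat // eqxx /= => /eqP [eb ew]; rewrite eb in e.
by exists u', t; split; [exact: UBit E e | | rewrite ev ew].
Qed.

End Reading.

(** A Mealy machine, possibly with infinitely many states, that outputs a word for each bit read. *)
Fixpoint transduce {S : Type} (g : S * bool -> S * seq bool) (s : S)
    (w : seq bool) : seq bool :=
  if w is b :: w' then (g (s, b)).2 ++ transduce g (g (s, b)).1 w' else [::].

Fixpoint transduced {S : Type} (g : S * bool -> S * seq bool) (s : S)
    (w : seq bool) : S :=
  if w is b :: w' then transduced g (g (s, b)).1 w' else s.

Lemma transduce_cat S (g : S * bool -> S * seq bool) s w1 w2 :
  transduce g s (w1 ++ w2) = transduce g s w1 ++ transduce g (transduced g s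
    w1) w2.
Proof. by elim: w1 s => //= b w1 IH s; rewrite IH catA. Qed.

Section Transducer.
Variables (U : machine) (S : Type) (encS : encodable S).
Variables (ini : seq bool -> S) (g : S * bool -> S * seq bool) (pi pg : prim).
Hypothesis piE : forall x, eval pi (encode x) = encode (ini x).
Hypothesis pgE : forall x, eval pg (encode x) = encode (g x).

(** Register 2 accumulates the code of the auxiliary word, last bit first. Register 0 counts the
    moves of the head, for [rewind_aux] to undo them. *)
Definition read_aux :=
  CAux 1 (shift 1 cmkpair ;; cmove 1 2 ;; CInc 2 ;; CInc 0).

Definition rewind_aux := CWhile 0 (CDec 0 ;; CAuxL).

Definition emit_list := CWhile 3 (CDec 3 ;; shift 3 cunpair ;;
  CEmit 4 ;; cclear 4 ;; cmove 5 3).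

(** Register 1 holds the code of the transducer state. Register 0 holds 1 throughout, which makes
    the loop around this body endless. *)
Definition main_body := CRead 2 ;; shift 1 cmkpair ;; shift 1 (cprim pg) ;;
  shift 1 cunpair ;; cmove 2 1 ;; emit_list.

Definition prologue := read_aux ;; rewind_aux ;; shift 2 (cprim pi) ;;
  cmove 2 1 ;; CInc 0.

Definition transducer_code : seq instr :=
  IInit :: compile 1 (prologue ;; CWhile 0 main_body).

Local Notation AState s u o := (@AState U s u o).
Local Notation exec := (@exec U).

Lemma set_aux_twice (u : config U) t t' : set_aux (set_aux u t) t' = set_aux u
  t'.
Proof. by congr Config; apply/funext => -[[]|]. Qed.

Lemma exec_read_aux (u : config U) o (a acc : seq bool) l n :
  aux u = Tape l (map Some a) ->
  exec read_aux (AState (stk [:: n; 0; encode acc]) u o)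
    (AState (stk [:: n + size a; 0; encode (catrev a acc)])
      (set_aux u (Tape (catrev (map Some a) l) [::])) o).
Proof.
elim: a u acc l n => [|b a IH] u acc l n e /=.
  rewrite addn0; have -> : set_aux u (Tape l [::]) = u.
    by case: u e => q t c /= e; congr Config; apply/funext => -[[]|];
      rewrite -?e.
  by apply: EAux0; rewrite e.
apply: EAuxS; first by rewrite e.
  rewrite stk_upd [stk _ 1]/= add0n; apply: ESeq.
    exact: (pexec_shift [:: n] (pexec_mkpair b (encode acc))).
  apply: ESeq; first exact: pexec_move.
  apply: ESeq; first exact: pexec_inc.
  exact: pexec_inc.
rewrite e /= add0n -(addSnnS n).
have := IH (set_aux u (Tape (Some b :: l) (map Some a))) (b :: acc) _ n.+1
  erefl.
by rewrite set_aux_twice.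
Qed.

Lemma exec_rewind_aux (u : config U) o x l r :
  exists2 t, tape_eq t (Tape [::] (catrev l r)) &
  exec rewind_aux (AState (stk [:: size l; 0; x]) (set_aux u (Tape l r)) o)
    (AState (stk [:: 0; 0; x]) (set_aux u t) o).
Proof.
elim: l r => [|s l IH] r /=.
  by exists (Tape [::] r); [exact: tape_eq_refl | exact: EWhile0].
have [t ht et] := IH (s :: head None r :: behead r).
exists t.
  apply: tape_eq_trans ht _; split=> //= i.
  rewrite !catrevE !nth_cat; case: ltnP => // _.
  by case: (_ - _) => [|j] //=; case: r {IH et} => //= ; case: j => //= j;
    rewrite nth_nil.
apply: EWhileS => //; last exact: et.
apply: ESeq; first exact: pexec_dec.
have := @EAuxL U (stk [:: size l; 0; x]) (set_aux u (Tape (s :: l) r)) o.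
by rewrite set_aux_twice.
Qed.

Lemma exec_emit_list u o x y (w : seq bool) :
  exec emit_list (AState (stk [:: x; y; 0; encode w]) u o)
    (AState (stk [:: x; y]) u (o ++ w)).
Proof.
elim: w o => [|b w IH] o.
  by rewrite cats0 -(stk_cat0 [:: x; y] 2); exact: EWhile0.
apply: EWhileS => //.
  apply: ESeq; first exact: pexec_dec.
  apply: ESeq.
    exact: (pexec_shift [:: x; y;
      0] (pexec_unpair (cpair (encode b) (encode w)))).
  rewrite cpairK /=.
  apply: ESeq; first exact: EEmit.
  apply: ESeq; first exact: pexec_clear.
  exact: pexec_move.
rewrite /= -cat_rcons add0n (stk_cat0 [:: x; y; 0; encode w] 2).
by have := IH (rcons o b); rewrite /stk /=; case: b.
Qed.

Lemma exec_main_body u o s b u' : uread u b u' ->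
  exec main_body (AState (stk [:: 1; encode s]) u o)
    (AState (stk [:: 1; encode (g (s, b)).1]) u' (o ++ (g (s, b)).2)).
Proof.
move=> ur; apply: ESeq; first exact: ERead ur.
rewrite stk_upd [stk _ 2]/= add0n; apply: ESeq.
  exact: (pexec_shift [:: 1] (pexec_mkpair (encode s) b)).
apply: ESeq; first exact: (pexec_shift [:: 1] (pexec_prim pg _)).
rewrite (pgE (s, b)).
apply: ESeq; first exact: (pexec_shift [:: 1] (pexec_unpair _)).
rewrite cpairK; apply: ESeq; first exact: pexec_move.
rewrite /= add0n; exact: exec_emit_list.
Qed.

Local Notation code := transducer_code.

(** After the prologue the simulated [U] is in its initial configuration, except for a trailing
    blank on the auxiliary tape that [represents] absorbs. *)
Lemma transducer_start a y p : exists off,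
  code_at code off (compile off (CWhile 0 main_body)) /\
  forall st, @reaches U code off
     (AState (stk [:: 1; encode (ini (rev a))]) (init U a y p) [::]) off st ->
  exists k, represents off st (run (code_machine U code) a y p k).
Proof.
have cat1 : code_at code 1 (compile 1 (prologue ;; CWhile 0 main_body)).
  by exists [:: IInit], [::]; rewrite cats0.
have := cat1; rewrite compile_seq => /code_at_cat[c1 c2].
exists (1 + size (compile 1 prologue)); split=> // st hst.
have h0 : @represents U code 1 (AState (stk [::]) (init U a y p) [::])
    (tstep (init (code_machine U code) a y p)).
  apply: (reach_init (pc := 0)) => //; first exact: nth_nil.
  by case=> [[]|w] /=; exact: tape_eq_refl.
have hr := @exec_read_aux (init U a y p) [::] a [::] [::] 0 erefl.
have [t ht hw] := @exec_rewind_aux (init U a y p) [::]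
  (encode (catrev a [::])) (catrev (map Some a) [::]) [::].
have hp : exec prologue (AState (stk [::]) (init U a y p) [::])
    (AState (stk [:: 1; encode (ini (rev a))]) (set_aux (init U a y p) t) [::]).
  rewrite -(stk_cat0 [::] 3); apply: ESeq; first exact: hr.
  apply: ESeq.
    by move: hw; rewrite catrevE cats0 size_rev size_map; exact.
  apply: ESeq; first exact: (pexec_shift [:: 0; 0] (pexec_prim pi _)).
  rewrite piE; apply: ESeq; first exact: pexec_move.
  rewrite -(stk_cat0 [:: 1; _] 1); exact: pexec_inc.
have [k hk] := compile_correct hp c1 h0.
have hk' : represents (1 + size (compile 1 prologue))
   (AState (stk [:: 1; encode (ini (rev a))]) (init U a y p) [::])
   (iter k (@tstep U code) (tstep (init (code_machine U code) a y p))).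
  case: hk => e1 e2 e3 e4; split=> // -[j|w]; last exact: (e2 (inr w)).
  case: j; [exact: (e2 (inl Program)) | exact: (e2 (inl Condition)) |].
  apply: tape_eq_trans (e2 (inl Auxiliary)) _.
  by move: ht; rewrite !catrevE !cats0 revK; exact.
have [k2 hk2] := hst _ hk'; exists (k2 + (k + 1)).
by rewrite /run !iterD.
Qed.

Lemma transducer_emits a y p w : emits U a y p w ->
  emits (code_machine U code) a y p (transduce g (ini (rev a)) w).
Proof.
move=> [t /prefixP[w2 e]]; have [off [cat h]] := transducer_start a y p.
(* One round of the endless loop per bit: the body is a terminating command covered by
   [compile_correct], and the rounds are chained by [reaches_trans]. The surplus output [w2] of [U]
   only lengthens the result. *)
suff H u (s : S) o v t' : cout (iter t' (fun c : config U =>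
  odflt c (step c)) u) = cout u ++ v ->
    exists (s' : S) u', @reaches U code off (AState (stk [:: 1;
      @encode S encS s]) u o) off
      (AState (stk [:: 1; @encode S encS s']) u' (o ++ transduce g s v)).
  have [s' [u' r]] := H (init U a y p) (ini (rev a)) [::] (w ++ w2) t e.
  have [k [_ _ _ ho]] := h _ r; exists k.
  by rewrite ho /= transduce_cat prefix_prefix.
elim: v u s o t' => [|b v IH] u s o t' e'.
  by exists s, u; rewrite cats0; exact: reaches_refl.
have [u1 [t1 [h1 h2 /IH h3]]] := run_uread e'.
have [s' [u' r]] := h3 (g (s, b)).1 (o ++ (g (s, b)).2).
exists s', u'; rewrite /= catA; apply: reaches_trans r.
have := cat; rewrite compile_while => /code_at_cons[lt f].
move=> /code_at_cat[c1 /code_at_cons[lt' f' _]].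
apply: reaches_trans; first exact: reach_jz f.
apply: reaches_trans; first exact: compile_correct (exec_main_body o s h1) c1.
exact: reach_jmp f'.
Qed.

End Transducer.

(** The auxiliary word enters through the initial state, computed at run time, so [T] is the same
    for all [a]. The reversal reflects the order in which the prologue collects bits. *)
Theorem transducer_machine (U : machine) S (encS : encodable S)
    (ini : seq bool -> S) (g : S * bool -> S * seq bool) :
  computable ini -> computable g ->
  exists2 T, prefix_machine T & forall a y p w,
    emits U a y p w -> emits T a y p (transduce g (ini (rev a)) w).
Proof.
move=> [pi piE] [pg pgE]; exists (code_machine U (transducer_code pi pg)).
  exact: code_machine_prefix.
by move=> a y p w; exact: transducer_emits.
Qed.

(** * Closure properties of computable functions *)

(** Surjectivity of the pairing, by which [PPair PLeft PRight] is a program for the identity. *)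
Lemma unpairK x : cpair (unpair x).1 (unpair x).2 = x.
Proof.
have h p : cpair (cstep p).1 (cstep p).2 = (cpair p.1 p.2).+1.
  by case: p => a [|b]; rewrite /cpair /= ?add0n ?addn0 ?addnS ?addSn.
by elim: x => //= x IH; rewrite h IH.
Qed.

Lemma encode_cons T (encT : encodable T) (x : T) s :
  encode (x :: s) = (cpair (encode x) (encode s)).+1.
Proof. by []. Qed.

Section Closure.
Context {X : Type} {encX : encodable X}.

Lemma computable_id : computable (fun x : X => x).
Proof. by exists (PPair PLeft PRight) => x; exact: unpairK. Qed.

Lemma computable_comp S T {_ : encodable S} {_ : encodable T}
    (f : S -> T) (g : X -> S) :
  computable f -> computable g -> computable (fun x => f (g x)).
Proof. by move=> [p hp] [q hq]; exists (PComp p q) => x /=; rewrite hq hp. Qed.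

Lemma computable_pair S T {_ : encodable S} {_ : encodable T}
    (f : X -> S) (g : X -> T) :
  computable f -> computable g -> computable (fun x => (f x, g x)).
Proof. by move=> [p hp] [q hq]; exists (PPair p q) => x /=; rewrite hq hp. Qed.

Lemma computable_fst S T {_ : encodable S} {_ : encodable T} (f : X -> S * T) :
  computable f -> computable (fun x => (f x).1).
Proof. by move=> [p hp]; exists (PComp PLeft p) => x /=; rewrite hp cpairK. Qed.

Lemma computable_snd S T {_ : encodable S} {_ : encodable T} (f : X -> S * T) :
  computable f -> computable (fun x => (f x).2).
Proof. by move=> [p hp]; exists (PComp PRight p) => x /=;
  rewrite hp cpairK. Qed.

Lemma computable_const T {encT : encodable T} (c : T) :
  computable (fun _ : X => c).
Proof.
have h n : exists p, forall x, eval p x = n.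
  elim: n => [|n [p hp]]; first by exists PZero.
  by exists (PComp PSucc p) => x /=; rewrite hp.
by have [p hp] := h (encT c); exists p => x; exact: hp.
Qed.

Lemma computable_succ (f : X -> nat) :
  computable f -> computable (fun x => (f x).+1).
Proof. by move=> [p hp]; exists (PComp PSucc p) => x /=; rewrite hp. Qed.

Lemma computable_rec T {_ : encodable T} (f : X -> T) (g : X -> nat -> T -> T)
    (n : X -> nat) :
  computable f -> computable (fun q : X * (nat * T) => g q.1 q.2.1 q.2.2) ->
  computable n ->
  computable (fun x => iteri (n x) (fun i v => g x i v) (f x)).
Proof.
move=> [pf hf] [pg hg] [pn hn].
exists (PComp (PRec pf pg) (PPair (PPair PLeft PRight) pn)) => x /=.
rewrite unpairK cpairK hn hf; rewrite /encode /encodable_nat /=.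
elim: (n x) => //= k IH; rewrite [X in cpair k X]IH.
exact: (hg (x, (k, iteri k (fun i v => g x i v) (f x)))).
Qed.

(** A recursion whose bound is the code of the list. Code 0 gives the base case; for code
    [(cpair h t).+1] only the last round matters, whose index is exactly [cpair h t], and the
    previous value is dropped. *)
Lemma computable_case T S {_ : encodable T} {_ : encodable S}
    (l : X -> seq T) (a : X -> S) (b : X -> T -> seq T -> S) :
  computable l -> computable a ->
  computable (fun q : X * (T * seq T) => b q.1 q.2.1 q.2.2) ->
  computable (fun x => match l x with h :: t => b x h t | [::] => a x end).
Proof.
move=> [pl hl] [pa ha] [pb hb].
exists (PComp (PRec pa (PComp pb (PPair PLeft (PComp PLeft PRight))))
          (PPair (PPair PLeft PRight) pl)) => x /=.
rewrite unpairK cpairK hl; case: (l x) => [|h t]; first exact: ha.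
rewrite encode_cons /= !cpairK; exact: (hb (x, (h, t))).
Qed.

Lemma computable_cons T {_ : encodable T} (h : X -> T) (t : X -> seq T) :
  computable h -> computable t -> computable (fun x => h x :: t x).
Proof.
move=> [p hp] [q hq]; exists (PComp PSucc (PPair p q)) => x /=.
by rewrite hp hq.
Qed.

(** A recursion with zero or one rounds, starting from the value of the else branch. *)
Lemma computable_if T {_ : encodable T} (b : X -> bool) (f g : X -> T) :
  computable b -> computable f -> computable g ->
  computable (fun x => if b x then f x else g x).
Proof.
move=> cb [pf hf] cg.
have [| |q hq] := @computable_rec _ _ g (fun x _ _ => f x) (fun x => b x) cg.
- by exists (PComp pf PLeft) => x /=; rewrite cpairK hf.
- by case: cb => pb hb; exists pb.
- by exists q => x; rewrite hq; case: (b x).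
Qed.

End Closure.

Lemma computable_fun2 S1 S2 T X {_ : encodable S1} {_ : encodable S2}
    {_ : encodable T} {_ : encodable X} (F : S1 -> S2 -> T)
    (f : X -> S1) (g : X -> S2) :
  computable (fun q : S1 * S2 => F q.1 q.2) -> computable f -> computable g ->
  computable (fun x => F (f x) (g x)).
Proof.
move=> hF hf hg; exact: (computable_comp hF (computable_pair hf hg)).
Qed.

Lemma computable_encode X T {_ : encodable X} {_ : encodable T} (f : X -> T) :
  computable f -> computable (fun x => encode (f x)).
Proof. by case=> p hp; exists p. Qed.

Create HintDb computable discriminated.

Lemma computable_proj1 S T {encS : encodable S} {encT : encodable T} :
  computable (@fst S T).
Proof. exact: (computable_fst computable_id). Qed.

Lemma computable_proj2 S T {encS : encodable S} {encT : encodable T} :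
  computable (@snd S T).
Proof. exact: (computable_snd computable_id). Qed.
#[local] Hint Resolve computable_proj1 computable_proj2 : computable.

(** Follows the syntax of the function in the goal; heads [F] are looked up among the hints
    registered so far. Conditionals and matches on lists are tried last. *)
Ltac computable_step :=
  first [apply computable_id | apply computable_const |
  match goal with
  | |- computable (fun x => (@?f x, @?g x)) =>
    apply (@computable_pair _ _ _ _ _ _ f g)
  | |- computable (fun x => fst (@?f x)) =>
    apply (@computable_fst _ _ _ _ _ _ f)
  | |- computable (fun x => snd (@?f x)) =>
    apply (@computable_snd _ _ _ _ _ _ f)
  | |- computable (fun x => S (@?f x)) => apply (@computable_succ _ _ f)
  | |- computable (fun x => nat_of_bool (@?f x)) =>
    apply (@computable_encode _ _ _ _ f)
  | |- computable (fun x => (@?f x) :: (@?g x)) =>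
    apply (@computable_cons _ _ _ _ f g)
  | |- computable (fun x => iteri (@?n x) (fun i v => @?g x i v) (@?f x)) =>
      apply (@computable_rec _ _ _ _ f g n)
  | |- computable (fun x => ?F (@?f x) (@?g x)) =>
      apply (@computable_fun2 _ _ _ _ _ _ _ _ F f g);
        [by eauto with computable nocore|..]
  | |- computable (fun x => ?F (@?f x)) =>
      apply (@computable_comp _ _ _ _ _ _ F f);
        [by eauto with computable nocore|]
  | |- _ => first [by eauto with computable nocore
                  | apply computable_if | apply computable_case]
  end].
Ltac computable_tac := repeat (computable_step; cbn beta).

(** * Arithmetic of natural numbers *)

Lemma computable_addn : computable (fun q => q.1 + q.2).
Proof.
have [p hp] : computable (fun q : nat * nat =>
    iteri q.2 (fun _ v => v.+1) q.1) by computable_tac.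
by exists p => -[a b]; rewrite hp /=; congr encode; elim: b => /= [|b ->]; lia.
Qed.
#[local] Hint Resolve computable_addn : computable.

Lemma computable_muln : computable (fun q => q.1 * q.2).
Proof.
have [p hp] : computable (fun q : nat * nat =>
    iteri q.2 (fun _ v => v + q.1) 0) by computable_tac.
by exists p => -[a b]; rewrite hp /=; congr encode; elim: b => /= [|b ->]; lia.
Qed.
#[local] Hint Resolve computable_muln : computable.

Lemma computable_predn : computable predn.
Proof.
have [p hp] : computable (fun q : nat =>
    iteri q (fun i v => i) 0) by computable_tac.
by exists p => -[|a]; rewrite hp.
Qed.
#[local] Hint Resolve computable_predn : computable.

Lemma computable_subn : computable (fun q => q.1 - q.2).
Proof.
have [p hp] : computable (fun q : nat * nat =>
    iteri q.2 (fun _ v => v.-1) q.1) by computable_tac.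
by exists p => -[a b]; rewrite hp /=; congr encode; elim: b => /= [|b ->]; lia.
Qed.
#[local] Hint Resolve computable_subn : computable.

Lemma computable_leq : computable (fun q => q.1 <= q.2).
Proof.
have [p hp] : computable (fun q : nat * nat =>
    iteri (q.1 - q.2) (fun _ _ => false) true) by computable_tac.
exists p => -[a b]; rewrite hp /= -subn_eq0; congr encode; by case: (a - b).
Qed.
#[local] Hint Resolve computable_leq : computable.

Lemma computable_andb : computable (fun q => q.1 && q.2).
Proof.
have [p hp] : computable (fun q : bool * bool =>
    if q.1 then q.2 else false) by computable_tac.
by exists p => -[[] b]; rewrite hp.
Qed.
#[local] Hint Resolve computable_andb : computable.

Lemma computable_eqn : computable (fun q : nat * nat => q.1 == q.2).
Proof.
have [p hp] : computable (fun q : nat * nat =>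
    (q.1 <= q.2) && (q.2 <= q.1)) by computable_tac.
by exists p => -[a b]; rewrite hp -eqn_leq.
Qed.
#[local] Hint Resolve computable_eqn : computable.

Definition rec_modn a d :=
  iteri a (fun _ r => if r.+1 == d then 0 else r.+1) 0.

Lemma rec_modnE a d : 0 < d -> rec_modn a d = a %% d.
Proof.
move=> d0; elim: a => [|a IH]; first by rewrite mod0n.
rewrite /rec_modn /= -/(rec_modn a d) IH -(addn1 a) -modnDml addn1.
have := ltn_pmod a d0; rewrite leq_eqVlt; case: eqP => [->|_ /= h].
  by rewrite modnn.
by rewrite [RHS]modn_small.
Qed.

Definition rec_divn a d :=
  iteri a (fun i v => v + (rec_modn i.+1 d == 0)) 0.

(** A bounded search in place of Euclid's algorithm: the last common divisor met among 1, ..., [d]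
    is the greatest. *)
Definition rec_gcdn a d := iteri d
  (fun i v => if (rec_modn a i.+1 == 0) && (rec_modn d i.+1 == 0) then i.+1
    else v) 1.

Lemma rec_divnE a d : 0 < d -> rec_divn a d = a %/ d.
Proof.
move=> d0; elim: a => [|a IH]; first by rewrite div0n.
have -> : rec_divn a.+1 d = rec_divn a d + (rec_modn a.+1 d == 0) by [].
by rewrite IH rec_modnE // divnS // addnC.
Qed.

Lemma rec_gcdnE a d : 0 < d -> rec_gcdn a d = gcdn a d.
Proof.
move=> d0; rewrite /rec_gcdn; set F := (F in iteri _ F _); pose G k :=
  iteri k F 1; rewrite -/(G d).
have GS k : G k.+1 = if k.+1 %| gcdn a d then k.+1 else G k.
  by rewrite dvdn_gcd /dvdn -!rec_modnE.
have G1 k : G k %| gcdn a d.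
  by elim: k => [|k IH]; [exact: dvd1n | rewrite GS; case: ifP].
have G2 k e : e <= k -> e %| gcdn a d -> e <= G k.
  elim: k => [|k IH]; first by rewrite leqn0 => /eqP ->.
  rewrite leq_eqVlt ltnS GS => /orP[/eqP -> -> // |h1 h2].
  by case: ifP => _; [exact: leqW | exact: IH].
apply/eqP; rewrite eqn_leq dvdn_leq ?gcdn_gt0 ?d0 ?orbT //=.
by apply: G2; rewrite ?dvdnn // dvdn_leq ?dvdn_gcdr.
Qed.

Lemma computable_modn : computable (fun q => rec_modn q.1 q.2).
Proof. rewrite /rec_modn; computable_tac. Qed.
#[local] Hint Resolve computable_modn : computable.

Lemma computable_divn : computable (fun q => rec_divn q.1 q.2).
Proof. rewrite /rec_divn; computable_tac. Qed.
#[local] Hint Resolve computable_divn : computable.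

Lemma computable_gcdn : computable (fun q => rec_gcdn q.1 q.2).
Proof. rewrite /rec_gcdn; computable_tac. Qed.
#[local] Hint Resolve computable_gcdn : computable.

(** * Lists *)

Section Lists.
Context {X T S : Type} {encX : encodable X} {encT : encodable T} {encS :
  encodable S}.

(** Lets the code of a list serve as the number of rounds in a fold over it. *)
Lemma size_encode (s : seq T) : size s <= encode s.
Proof.
elim: s => //= x s IH; rewrite encode_cons ltnS.
exact: leq_trans IH (leq_cpairr _ _).
Qed.

(** Each round moves one element from the remaining list into the accumulator; the rounds left over
    after the list is exhausted do nothing. *)
Lemma computable_foldl (l : X -> seq T) (z : X -> S) (F : X -> S -> T -> S) :
  computable l -> computable z ->
  computable (fun q : X * (S * T) => F q.1 q.2.1 q.2.2) ->
  computable (fun x => foldl (fun a b => F x a b) (z x) (l x)).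
Proof.
move=> cl cz cF.
have cF' (Y : Type) (encY : encodable Y) (x : Y -> X) (a : Y -> S) (b : Y ->
  T) :
    computable x -> computable a -> computable b ->
    computable (fun y => F (x y) (a y) (b y)).
  move=> cx ca cb.
  exact: (computable_comp cF (computable_pair cx (computable_pair ca cb))).
have [|p hp] := @computable_snd X _ (seq T) S _ _ (fun x =>
  iteri (encode (l x))
    (fun _ p => match p.1 with h :: t => (t, F x p.2 h) | [::] => p end)
    (l x, z x)).
  apply: computable_rec; [exact: computable_pair | | exact: computable_encode].
  apply: computable_case; [computable_tac|computable_tac|].
  by apply: computable_pair; [computable_tac | apply: cF'; computable_tac].
exists p => x; rewrite hp; congr encode.
move: (encode (l x)) (size_encode (l x)) => n; move: (z x) (l x) => a s {hp}.
set f := fun _ _ => _; have h k b t : iteri k f (t, b) =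
    (drop k t, foldl (fun a b => F x a b) b (take k t)).
  elim: k => [|k IH] /=; first by rewrite take0 drop0.
  rewrite {1}/f IH /=; case: (ltnP k (size t)) => hk; last first.
    by rewrite drop_oversize // !take_oversize ?drop_oversize // ltnW.
  have [y0 _] : exists y : T, True by case: (t) hk => // y; exists y.
  by rewrite (drop_nth y0 hk) (take_nth y0 hk) -cats1 foldl_cat.
by move=> hs; rewrite h /= take_oversize.
Qed.

End Lists.

Lemma computable_size T (encT : encodable T) : computable (@size T).
Proof.
have [p hp] : computable (fun s : seq T => foldl (fun n _ => n.+1) 0 s).
  by apply: computable_foldl; computable_tac.
exists p => s; rewrite hp; congr encode.
suff h n : foldl (fun n (_ : T) => n.+1) n s = n + size s by rewrite h.
by elim: s n => [|x s IH] n /=; rewrite ?addn0 ?IH ?addSnnS.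
Qed.
#[local] Hint Resolve computable_size : computable.

Lemma computable_catrev T (encT : encodable T) :
  computable (fun q : seq T * seq T => catrev q.1 q.2).
Proof.
have [p hp] : computable (fun q : seq T * seq T =>
    foldl (fun a b => b :: a) q.2 q.1).
  by apply: computable_foldl; computable_tac.
exists p => -[s t]; rewrite hp; congr encode => /=.
by elim: s t => //= x s IH t; rewrite IH.
Qed.
#[local] Hint Resolve computable_catrev : computable.

Lemma computable_rev T (encT : encodable T) : computable (@rev T).
Proof. by rewrite /rev; computable_tac. Qed.
#[local] Hint Resolve computable_rev : computable.

Lemma computable_cat T (encT : encodable T) :
  computable (fun q : seq T * seq T => q.1 ++ q.2).
Proof.
have [p hp] : computable (fun q : seq T * seq T => catrev (rev q.1) q.2).
  by computable_tac.
by exists p => q; rewrite hp catrevE revK.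
Qed.
#[local] Hint Resolve computable_cat : computable.

Definition rec_nth T (x0 : T) (s : seq T) i :=
  match iteri i (fun _ t => if t is _ :: t' then t' else [::]) s
  with x :: _ => x | [::] => x0 end.

Lemma rec_nthE T (x0 : T) s i : rec_nth x0 s i = nth x0 s i.
Proof.
rewrite /rec_nth; set f := fun _ _ => _.
have -> : iteri i f s = drop i s.
  elim: i => [|i IH] /=; first by rewrite drop0.
  rewrite {1}/f IH -addn1 addnC -drop_drop.
  by case: (drop i s) => //= y t; rewrite drop0.
by rewrite -{2}(addn0 i) -nth_drop; case: (drop i s).
Qed.

Lemma computable_nth T (encT : encodable T) (x0 : T) :
  computable (fun q : seq T * nat => nth x0 q.1 q.2).
Proof.
have [p hp] : computable (fun q => rec_nth x0 q.1 q.2).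
  apply: computable_case; [|exact: computable_const|computable_tac].
  apply: computable_rec; [computable_tac| |computable_tac].
  by apply: computable_case; computable_tac.
by exists p => q; rewrite hp rec_nthE.
Qed.
#[local] Hint Resolve computable_nth : computable.

(** * Rational complex arithmetic *)

(* [(p, q, d)] stands for [(p - q) / d]; a pair of such triples for a complex
   number. With this redundant representation, ring operations need no case
   analysis on signs. *)
Notation triple := (nat * nat * nat)%type.
Notation ctriple := (triple * triple)%type.

Definition fopp (x : triple) : triple := (x.1.2, x.1.1, x.2).
Definition fadd (x y : triple) : triple :=
  (x.1.1 * y.2 + y.1.1 * x.2, x.1.2 * y.2 + y.1.2 * x.2, x.2 * y.2).
Definition fmul (x y : triple) : triple :=
  (x.1.1 * y.1.1 + x.1.2 * y.1.2, x.1.1 * y.1.2 + x.1.2 * y.1.1, x.2 * y.2).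
Definition cf0 : ctriple := ((0, 0, 1), (0, 0, 1)).
Definition cfadd (x y : ctriple) : ctriple := (fadd x.1 y.1, fadd x.2 y.2).
Definition cfmul (x y : ctriple) : ctriple :=
  (fadd (fmul x.1 y.1) (fopp (fmul x.2 y.2)),
   fadd (fmul x.1 y.2) (fmul x.2 y.1)).
Definition cfconj (x : ctriple) : ctriple := (x.1, fopp x.2).

Lemma computable_fopp : computable fopp.
Proof. rewrite /fopp; computable_tac. Qed.
#[local] Hint Resolve computable_fopp : computable.

Lemma computable_fadd : computable (fun q => fadd q.1 q.2).
Proof. rewrite /fadd; computable_tac. Qed.
#[local] Hint Resolve computable_fadd : computable.

Lemma computable_fmul : computable (fun q => fmul q.1 q.2).
Proof. rewrite /fmul; computable_tac. Qed.
#[local] Hint Resolve computable_fmul : computable.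

Lemma computable_cfadd : computable (fun q => cfadd q.1 q.2).
Proof. rewrite /cfadd; computable_tac. Qed.
#[local] Hint Resolve computable_cfadd : computable.

Lemma computable_cfmul : computable (fun q => cfmul q.1 q.2).
Proof. rewrite /cfmul; computable_tac. Qed.
#[local] Hint Resolve computable_cfmul : computable.

Lemma computable_cfconj : computable cfconj.
Proof. rewrite /cfconj; computable_tac. Qed.
#[local] Hint Resolve computable_cfconj : computable.

Section Values.
Local Open Scope ring_scope.
Local Open Scope complex_scope.

Definition fval (x : triple) : rat := (x.1.1%:R - x.1.2%:R) / x.2%:R.

Definition cfrep (x : ctriple) (z : rat[i]) : Prop :=
  [/\ (0 < x.1.2)%N, (0 < x.2.2)%N & z = fval x.1 +i* fval x.2].

Lemma fval_opp x : fval (fopp x) = - fval x.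
Proof. by rewrite /fval /= -mulNr opprB. Qed.

Lemma fval_add x y : (0 < x.2)%N -> (0 < y.2)%N ->
  fval (fadd x y) = fval x + fval y.
Proof.
rewrite -!(ltr0n rat) => /lt0r_neq0 hx /lt0r_neq0 hy.
by rewrite /fval /= !natrD !natrM; field; rewrite hx hy.
Qed.

Lemma fval_mul x y : (0 < x.2)%N -> (0 < y.2)%N ->
  fval (fmul x y) = fval x * fval y.
Proof.
rewrite -!(ltr0n rat) => /lt0r_neq0 hx /lt0r_neq0 hy.
by rewrite /fval /= !natrD !natrM; field; rewrite hx hy.
Qed.

Lemma cfrep0 : cfrep cf0 0.
Proof. by split=> //; rewrite /fval /= subrr mul0r. Qed.

Lemma cfrep_add x y z w : cfrep x z -> cfrep y w -> cfrep (cfadd x y) (z + w).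
Proof.
move=> [x1 x2 ->] [y1 y2 ->]; split=> /=; rewrite ?muln_gt0 ?x1 ?x2 //.
by rewrite !fval_add.
Qed.

Lemma cfrep_mul x y z w : cfrep x z -> cfrep y w -> cfrep (cfmul x y) (z * w).
Proof.
move=> [x1 x2 ->] [y1 y2 ->]; split=> /=; rewrite ?muln_gt0 ?x1 ?x2 ?y1 ?y2 //.
by rewrite !fval_add ?fval_opp ?fval_mul //= muln_gt0 ?x1 ?x2 ?y1 ?y2.
Qed.

Lemma cfrep_conj x z : cfrep x z -> cfrep (cfconj x) (conjc z).
Proof. by move=> [x1 x2 ->]; split=> //=; rewrite fval_opp. Qed.

Definition cfsum (n : nat) (f : nat -> ctriple) : ctriple :=
  iteri n (fun i v => cfadd v (f i)) cf0.

Lemma cfrep_sum n (f : nat -> ctriple) (g : 'I_n -> rat[i]) :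
  (forall i : 'I_n, cfrep (f i) (g i)) -> cfrep (cfsum n f) (\sum_(i < n) g i).
Proof.
elim: n g => [|n IH] g h; first by rewrite big_ord0; exact: cfrep0.
rewrite big_ord_recr /=; apply: cfrep_add; last exact: (h ord_max).
by apply: IH => i; exact: (h (widen_ord (leqnSn n) i)).
Qed.

End Values.

(** * Codes of fractions in lowest terms *)

Definition absdiff p q := (p - q) + (q - p).
Definition reduce a d := rec_divn a (rec_gcdn a d).
Definition reduce_den a d := rec_divn d (rec_gcdn a d).
Definition rec_enc_nat n := iteri n (fun _ v => true :: v) [:: false].
(** [enc_rat] uses the reduced numerator and denominator, so the redundant triple is normalized
    here, at output time only. The predecessor is due to [Negz n] being [- n.+1]. *)
Definition enc_frac (x : triple) : seq bool :=
  (if x.1.1 < x.1.2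
   then false :: rec_enc_nat (reduce (absdiff x.1.1 x.1.2) x.2).-1
   else true :: rec_enc_nat (reduce (absdiff x.1.1 x.1.2) x.2)) ++
  true :: rec_enc_nat (reduce_den (absdiff x.1.1 x.1.2) x.2).
Definition enc_cfrac (x : ctriple) : seq bool := enc_frac x.1 ++ enc_frac x.2.

Lemma rec_enc_natE n : rec_enc_nat n = enc_nat n.
Proof. by rewrite /rec_enc_nat /enc_nat; elim: n => //= n ->. Qed.

Section EncFrac.
Local Open Scope ring_scope.

Lemma enc_fracE x : (0 < x.2)%N -> enc_frac x = enc_rat (fval x).
Proof.
case: x => -[p q] d /= d0; rewrite /enc_frac /enc_rat /= !rec_enc_natE.
rewrite /reduce /reduce_den; set a := absdiff p q.
rewrite rec_gcdnE //; set g := gcdn a d.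
have g0 : (0 < g)%N by rewrite gcdn_gt0 d0 orbT.
rewrite !rec_divnE //; set a' := (a %/ g)%N; set d' := (d %/ g)%N.
have ea : a = (a' * g)%N by rewrite divnK // dvdn_gcdl.
have ed : d = (d' * g)%N by rewrite divnK // dvdn_gcdr.
have d'0 : (0 < d')%N by move: d0; rewrite ed muln_gt0 => /andP[].
have co : coprime a' d'.
  rewrite /coprime -(eqn_pmul2r g0) mul1n; apply/eqP.
  by rewrite muln_gcdl -ea -ed.
have nz (n : nat) : (0 < n)%N -> n%:R != 0 :> rat by rewrite pnatr_eq0; case: n.
pose z : int := if (p < q)%N then - a'%:Z else a'%:Z.
have ez : fval (p, q, d) = z%:~R / (d'%:Z)%:~R.
  rewrite /fval /=.
  have -> : p%:R - q%:R = z%:~R * g%:R :> rat.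
    have -> : p%:R - q%:R = (p%:Z - q%:Z)%:~R :> rat by rewrite rmorphB.
    have -> : g%:R = (g%:Z)%:~R :> rat by [].
    rewrite -rmorphM; congr (_%:~R); rewrite /z.
    by move: ea; rewrite /a /absdiff; case: ifP => h1 h2; lia.
  by rewrite ed natrM; field; rewrite !nz.
have co' : coprime `|z| `|d'%:Z| by rewrite /z; case: ifP => _; rewrite ?abszN.
rewrite ez coprimeq_num // coprimeq_den //.
have -> : (d'%:Z == 0) = false by rewrite eqz_nat; apply/negbTE; rewrite -lt0n.
have -> : Num.sg d'%:Z = 1 by apply: gtr0_sg.
rewrite mul1r /z; case: ltnP => h; rewrite /enc_int //=.
(* In the negative case the reduced numerator is nonzero, hence the successor of the argument of
   [Negz]. *)
have : (0 < a')%N.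
  have : (0 < a)%N by rewrite /a /absdiff; lia.
  by rewrite ea muln_gt0 => /andP[].
by case: (a') => // k _; rewrite -NegzE.
Qed.

Lemma enc_cfracE x z : cfrep x z -> enc_cfrac x = enc_cplx z.
Proof. by case=> h1 h2 ->; rewrite /enc_cfrac /enc_cplx /= !enc_fracE. Qed.

End EncFrac.

Lemma computable_absdiff : computable (fun q => absdiff q.1 q.2).
Proof. rewrite /absdiff; computable_tac. Qed.
#[local] Hint Resolve computable_absdiff : computable.
Lemma computable_reduce : computable (fun q => reduce q.1 q.2).
Proof. rewrite /reduce; computable_tac. Qed.
#[local] Hint Resolve computable_reduce : computable.
Lemma computable_reduce_den : computable (fun q => reduce_den q.1 q.2).
Proof. rewrite /reduce_den; computable_tac. Qed.
#[local] Hint Resolve computable_reduce_den : computable.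
Lemma computable_enc_nat : computable rec_enc_nat.
Proof. rewrite /rec_enc_nat; computable_tac. Qed.
#[local] Hint Resolve computable_enc_nat : computable.
Lemma computable_enc_frac : computable enc_frac.
Proof. rewrite /enc_frac; computable_tac. Qed.
#[local] Hint Resolve computable_enc_frac : computable.
Lemma computable_enc_cfrac : computable enc_cfrac.
Proof. rewrite /enc_cfrac; computable_tac. Qed.
#[local] Hint Resolve computable_enc_cfrac : computable.

(** * Conjugation of coded matrices *)

(* [(true, n)] stands for [Posz n] and [(false, n)] for [Negz n]. *)
Notation token := (bool * nat)%type.

Definition tok0 : token := (true, 0).

(** [t] is the numerator, where [Negz n] subtracts [n.+1]. The denominator [u] is positive, so its
    magnitude is all that is read. *)
Definition tok_frac (t u : token) : triple :=
  ((if t.1 then t.2 else 0, if t.1 then 0 else t.2.+1), u.2).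

Definition tok_cfrac (l : seq token) (o : nat) : ctriple :=
  (tok_frac (nth tok0 l o) (nth tok0 l o.+1),
   tok_frac (nth tok0 l o.+2) (nth tok0 l o.+3)).

(** Two tokens for the dimensions come first; then four per entry, row by row. *)
Definition tok_entry (l : seq token) n i j := tok_cfrac l (2 + 4 * (i * n + j)).

(* Entry [(i, j)] of [tprod A 1%:M], or of its adjoint if [adj]. *)
Definition tensor_entry (adj : bool) (la : seq token) n i j : ctriple :=
  if rec_modn i n == rec_modn j n then
    if adj then cfconj (tok_entry la n (rec_divn j n) (rec_divn i n))
    else tok_entry la n (rec_divn i n) (rec_divn j n)
  else cf0.

Definition conj_entry adj (la lm : seq token) n d i j : ctriple :=
  cfsum d (fun k => cfsum d (fun l =>
    cfmul (cfmul (cfconj (tensor_entry adj la n k i)) (tok_entry lm d k l))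
          (tensor_entry adj la n l j))).

Definition conj_output adj (la lm : seq token) n d : seq bool :=
  rec_enc_nat d ++ rec_enc_nat d ++
  iteri d (fun i v => v ++
    iteri d (fun j w => w ++ enc_cfrac (conj_entry adj la lm n d i j)) [::])
      [::].

(* Tokens read so far (last first), whether a sign bit is expected next, and
   the sign and magnitude of the current token. The two dimensions, read
   first, are unsigned. *)
Notation lexer := (seq token * (bool * (bool * nat)))%type.

Definition lexer0 : lexer := ([::], (false, (true, 0))).

Definition lex (s : lexer) (b : bool) : lexer :=
  if s.2.1 then (s.1, (false, (b, 0)))
  else if b then (s.1, (false, (s.2.2.1, s.2.2.2.+1)))
  else ((s.2.2.1, s.2.2.2) :: s.1, (0 < size s.1, (true, 0))).

(** The dimensions announce the length of the code, so its end is recognized without lookahead.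
    [s.2.1] excludes a token that is still being read. *)
Definition lexed (s : lexer) : bool :=
  s.2.1 && (size s.1 == 2 + 4 * ((nth tok0 (rev s.1) 0).2 *
                                 (nth tok0 (rev s.1) 1).2)).

(** The tokens of [A] stay in the state; the lexer restarts after each matrix, so memory of earlier
    matrices is discarded. *)
Definition conj_step adj (sb : seq token * lexer * bool) :
    seq token * lexer * seq bool :=
  if lexed (lex sb.1.2 sb.2) then
    ((sb.1.1, lexer0), conj_output adj sb.1.1 (rev (lex sb.1.2 sb.2).1)
       (nth tok0 sb.1.1 0).2 (nth tok0 (rev (lex sb.1.2 sb.2).1) 0).2)
  else ((sb.1.1, lex sb.1.2 sb.2), [::]).

Definition conj_init (arev : seq bool) : seq token * lexer :=
  (rev (foldl lex lexer0 (rev arev)).1, lexer0).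

Lemma computable_tok_frac : computable (fun q => tok_frac q.1 q.2).
Proof. rewrite /tok_frac; computable_tac. Qed.
#[local] Hint Resolve computable_tok_frac : computable.
Lemma computable_tok_cfrac : computable (fun q => tok_cfrac q.1 q.2).
Proof. rewrite /tok_cfrac; computable_tac. Qed.
#[local] Hint Resolve computable_tok_cfrac : computable.
Lemma computable_lex : computable (fun q => lex q.1 q.2).
Proof. rewrite /lex; computable_tac. Qed.
#[local] Hint Resolve computable_lex : computable.
Lemma computable_lexed : computable lexed.
Proof. rewrite /lexed; computable_tac. Qed.
#[local] Hint Resolve computable_lexed : computable.

Lemma computable_conj_init : computable conj_init.
Proof.
rewrite /conj_init; computable_tac.
by apply: computable_foldl; computable_tac.
Qed.

Lemma computable_conj_output adj : computable
  (fun q : seq token * seq token * (nat * nat) =>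
     conj_output adj q.1.1 q.1.2 q.2.1 q.2.2).
Proof.
rewrite /conj_output /conj_entry /cfsum /tensor_entry /tok_entry.
computable_tac.
Qed.

Lemma computable_conj_step adj : computable (conj_step adj).
Proof.
rewrite /conj_step; computable_tac.
apply: (computable_comp (computable_conj_output adj)
  (g := fun sb : seq token * lexer * bool => ((sb.1.1, rev (lex sb.1.2 sb.2).1),
     ((nth tok0 sb.1.1 0).2, (nth tok0 (rev (lex sb.1.2 sb.2).1) 0).2)))).
computable_tac.
Qed.

(** * Token lists of matrices *)

Definition int_token (z : int) : token :=
  match z with Posz n => (true, n) | Negz n => (false, n) end.

Definition cplx_tokens (z : rat[i]) : seq token :=
  [:: int_token (numq (complex.Re z)); int_token (denq (complex.Re z));
      int_token (numq (complex.Im z)); int_token (denq (complex.Im z))].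

Definition entry_tokens m n (A : 'M[rat[i]]_(m, n)) : seq token :=
  flatten [seq cplx_tokens (A i j) | i <- enum 'I_m, j <- enum 'I_n].

Definition mx_tokens m n (A : 'M[rat[i]]_(m, n)) : seq token :=
  [:: (true, m), (true, n) & entry_tokens A].

Definition token_bits (t : token) : seq bool := t.1 :: enc_nat t.2.

Lemma enc_cplx_tokens z :
  enc_cplx z = flatten (map token_bits (cplx_tokens z)).
Proof.
have h w : enc_int w = token_bits (int_token w) by case: w.
by rewrite /enc_cplx /enc_rat !h /= cats0 -!catA.
Qed.

Lemma flatten_map_flatten S T (f : S -> seq T) (ss : seq (seq S)) :
  flatten (map f (flatten ss)) = flatten [seq flatten (map f s) | s <- ss].
Proof. by elim: ss => //= s ss IH; rewrite map_cat flatten_cat IH. Qed.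

Lemma enc_mx_tokens m n (A : 'M[rat[i]]_(m, n)) :
  enc_mx A = enc_nat m ++ enc_nat n ++ flatten (map token_bits (entry_tokens
    A)).
Proof.
rewrite /enc_mx /entry_tokens flatten_map_flatten map_allpairs;
  do 2!congr (_ ++ _).
congr flatten; congr flatten; apply: eq_map => i; apply: eq_map => j.
exact: enc_cplx_tokens.
Qed.

Lemma size_flatten_const T n (ss : seq (seq T)) :
  all (fun s => size s == n) ss -> size (flatten ss) = size ss * n.
Proof.
elim: ss => //= s ss IH /andP[/eqP e /IH]; rewrite size_cat => ->.
by rewrite e mulSn.
Qed.

Lemma nth_flatten_const T (x0 : T) n ss k r :
  all (fun s => size s == n) ss -> r < n ->
  nth x0 (flatten ss) (k * n + r) = nth x0 (nth [::] ss k) r.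
Proof.
elim: ss k => [|s ss IH] k; first by rewrite !nth_nil.
case: k => [|k] /= /andP[/eqP e h] rn.
- by rewrite nth_cat e rn.
- by rewrite nth_cat e mulSn -addnA ltnNge leq_addr /= addKn IH.
Qed.

Lemma all_size_entries m n (A : 'M[rat[i]]_(m, n)) :
  all (fun s => size s == 4)
    [seq cplx_tokens (A i j) | i <- enum 'I_m, j <- enum 'I_n].
Proof. by apply/allP => s /allpairsPdep[i [j [_ _ ->]]]. Qed.

Lemma all_size_rows T m n (f : 'I_m -> 'I_n -> T) :
  all (fun s => size s == n) [seq [seq f i j | j <- enum 'I_n] | i <- enum
    'I_m].
Proof. by rewrite all_map; apply/allP => i _ /=;
  rewrite size_map size_enum_ord. Qed.

Lemma size_entry_tokens m n (A : 'M[rat[i]]_(m, n)) :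
  size (entry_tokens A) = 4 * (m * n).
Proof.
rewrite (size_flatten_const (all_size_entries A)).
rewrite (size_flatten_const (all_size_rows _)) size_map size_enum_ord.
by rewrite mulnC.
Qed.

Lemma nth_entry_tokens m n (A : 'M[rat[i]]_(m, n)) (i : 'I_m) (j : 'I_n) r :
  r < 4 -> nth tok0 (mx_tokens A) (2 + 4 * (i * n + j) + r) =
           nth tok0 (cplx_tokens (A i j)) r.
Proof.
move=> r4; rewrite -addnA /= mulnC (nth_flatten_const _ _ (all_size_entries A)
  r4).
rewrite (nth_flatten_const _ _ (all_size_rows _) (ltn_ord j)).
rewrite (nth_map i) ?size_enum_ord // (nth_map j) ?size_enum_ord //.
by rewrite !nth_ord_enum.
Qed.

Section Entry.
Local Open Scope ring_scope.

Lemma tok_frac_rat (x : rat) :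
  (0 < (tok_frac (int_token (numq x)) (int_token (denq x))).2)%N /\
  fval (tok_frac (int_token (numq x)) (int_token (denq x))) = x.
Proof.
have := denq_gt0 x; case e: (denq x) => [d|d] // d0; split=> //.
rewrite -[RHS]divq_num_den e /fval /=; congr (_ / _).
case: (numq x) => [k|k] /=; first by rewrite subr0.
by rewrite sub0r NegzE rmorphN.
Qed.

Lemma tok_entry_rep m n (A : 'M[rat[i]]_(m, n)) (i : 'I_m) (j : 'I_n) :
  cfrep (tok_entry (mx_tokens A) n i j) (A i j).
Proof.
have h r := @nth_entry_tokens m n A i j r.
rewrite /tok_entry /tok_cfrac; set o := (2 + _)%N.
rewrite -(addn0 o) -!addnS !h //=.
have [h1 e1] := tok_frac_rat (complex.Re (A i j)).
have [h2 e2] := tok_frac_rat (complex.Im (A i j)).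
by split=> //; rewrite e1 e2; case: (A i j).
Qed.

Lemma ltn_divord n (i : 'I_(n * n)) : (i %/ n < n)%N.
Proof.
have n0 : (0 < n)%N by case: n i => [[]|].
by rewrite ltn_divLR.
Qed.

Definition divord n (i : 'I_(n * n)) : 'I_n := Ordinal (ltn_divord i).

Definition tensor_mx (adj : bool) n (A : 'M[rat[i]]_n) : 'M[rat[i]]_(n * n) :=
  \matrix_(i, j) if (i %% n == j %% n)%N then
    if adj then conjc (A (divord j) (divord i)) else A (divord i) (divord j)
  else 0.

(** Written as a double sum in the shape that [conj_entry] evaluates; [elem_conj_mx] identifies it
    with a matrix product. *)
Definition conj_mx adj n (A : 'M[rat[i]]_n) (M : 'M[rat[i]]_(n * n)) :
    'M[rat[i]]_(n * n) :=
  \matrix_(i, j) \sum_k \sum_l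
     conjc (tensor_mx adj A k i) * M k l * tensor_mx adj A l j.

Lemma tensor_entry_rep adj n (A : 'M[rat[i]]_n) (i j : 'I_(n * n)) :
  cfrep (tensor_entry adj (mx_tokens A) n i j) (tensor_mx adj A i j).
Proof.
have n0 : (0 < n)%N by case: n A i {j} => [A []|].
rewrite /tensor_entry mxE !rec_modnE // !rec_divnE //.
case: ifP => _; last exact: cfrep0.
have h i' j' := @tok_entry_rep n n A (@divord n i') (divord j').
by case: adj; [apply: cfrep_conj|]; exact: h.
Qed.

Lemma conj_entry_rep adj n (A : 'M[rat[i]]_n) M (i j : 'I_(n * n)) :
  cfrep (conj_entry adj (mx_tokens A) (mx_tokens M) n (n * n) i j)
    (conj_mx adj A M i j).
Proof.
rewrite mxE; apply: cfrep_sum => k; apply: cfrep_sum => l.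
apply: cfrep_mul; last exact: tensor_entry_rep.
apply: cfrep_mul; last exact: tok_entry_rep.
by apply: cfrep_conj; exact: tensor_entry_rep.
Qed.

End Entry.

Lemma iteri_cat T (f : nat -> seq T) n :
  iteri n (fun i v => v ++ f i) [::] = flatten [seq f i | i <- iota 0 n].
Proof.
elim: n => // n IH; rewrite [LHS]/= IH -[n.+1]addn1 iotaD map_cat flatten_cat.
by rewrite /= cats0.
Qed.

Lemma flatten_iota_enum T n (f : nat -> seq T) (g : 'I_n -> seq T) :
  (forall i : 'I_n, f i = g i) ->
  flatten [seq f i | i <- iota 0 n] = flatten [seq g i | i <- enum 'I_n].
Proof.
by move=> h; rewrite -val_enum_ord -map_comp; congr flatten; exact: eq_map.
Qed.

Lemma flatten_flatten T (sss : seq (seq (seq T))) :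
  flatten (flatten sss) = flatten (map flatten sss).
Proof. by elim: sss => //= ss sss IH; rewrite flatten_cat IH. Qed.

Lemma conj_outputE adj n (A : 'M[rat[i]]_n) M :
  conj_output adj (mx_tokens A) (mx_tokens M) n (n * n) = enc_mx (conj_mx adj A
    M).
Proof.
rewrite /conj_output /enc_mx !rec_enc_natE; do 2!congr (_ ++ _).
rewrite iteri_cat flatten_flatten -map_comp; apply: flatten_iota_enum => i /=.
rewrite iteri_cat; apply: flatten_iota_enum => j.
exact/enc_cfracE/conj_entry_rep.
Qed.

(** * Lexing a stream of matrix codes *)

Section Lexing.
Variables (adj : bool) (la : seq token).
Local Notation g := (conj_step adj).
Local Arguments conj_step : simpl never.

Lemma transduced_cat S (h : S * bool -> S * seq bool) s w1 w2 :
  transduced h s (w1 ++ w2) = transduced h (transduced h s w1) w2.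
Proof. by elim: w1 s => //= b w1 IH s; rewrite IH. Qed.

Lemma lex_enc_nat L sg k n : foldl lex (L, (false, (sg, k))) (enc_nat n) =
  ((sg, k + n) :: L, (0 < size L, (true, 0))).
Proof.
rewrite /enc_nat; elim: n k => [|n IH] k /=; first by rewrite /lex /= addn0.
by rewrite [lex _ true]/= IH addSnnS.
Qed.

Lemma lex_tokens L ts : 0 < size L ->
  foldl lex (L, (true, (true, 0))) (flatten (map token_bits ts)) =
  (catrev ts L, (true, (true, 0))).
Proof.
elim: ts L => //= -[b k] ts IH L L0;
  rewrite foldl_cat [lex _ _]/= lex_enc_nat L0.
exact: IH.
Qed.

Lemma lex_enc_mx m n (A : 'M[rat[i]]_(m, n)) :
  foldl lex lexer0 (enc_mx A) = (rev (mx_tokens A), (true, (true, 0))).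
Proof.
by rewrite enc_mx_tokens !foldl_cat /lexer0 !lex_enc_nat lex_tokens.
Qed.

Lemma conj_init_enc_mx m n (A : 'M[rat[i]]_(m, n)) :
  conj_init (rev (enc_mx A)) = (mx_tokens A, lexer0).
Proof. by rewrite /conj_init revK lex_enc_mx revK. Qed.

Lemma transduce_enc_nat L sg k n :
  let s := (la, (L, (false, (sg, k)))) in
  let r := g ((la, (L, (false, (sg, k + n)))), false) in
  transduce g s (enc_nat n) = r.2 /\ transduced g s (enc_nat n) = r.1.
Proof.
rewrite /enc_nat; elim: n k => [|n IH] k /=; first by rewrite addn0 cats0.
by have := IH k.+1; rewrite addSnnS.
Qed.

Lemma transduce_token L t :
  let s := (la, (L, (true, (true, 0)))) in
  let r := g ((la, (L, (false, t))), false) in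
  transduce g s (token_bits t) = r.2 /\ transduced g s (token_bits t) = r.1.
Proof.
case: t => b k; exact: (transduce_enc_nat L b 0 k).
Qed.

Lemma nth_rev_cons T (x0 : T) x l i : i < size l ->
  nth x0 (rev (x :: l)) i = nth x0 (rev l) i.
Proof. by move=> h; rewrite rev_cons nth_rcons size_rev h. Qed.

Local Arguments transduce : simpl never.
Local Arguments transduced : simpl never.

(** [L] already contains both dimensions, hence the target count. The count is missed, and nothing
    is output, until the last token of [ts]. *)
Lemma transduce_tokens L m n ts : 1 < size L ->
  nth tok0 (rev L) 0 = (true, m) -> nth tok0 (rev L) 1 = (true, n) ->
  size L + size ts = 2 + 4 * (m * n) -> 0 < size ts ->
  let s := (la, (L, (true, (true, 0)))) in
  let w := flatten (map token_bits ts) in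
  transduce g s w = conj_output adj la (rev L ++ ts) (nth tok0 la 0).2 m /\
  transduced g s w = (la, lexer0).
Proof.
elim: ts L => //= t ts IH L L1 e0 e1 es _.
rewrite -cat_cons -/(token_bits t) transduce_cat transduced_cat.
have [-> ->] := transduce_token L t.
have L0 : 0 < size L by exact: ltnW.
have -> : g (la, (L, (false, t)), false) =
    if (size L).+1 == 2 + 4 * (m * n)
    then ((la, lexer0), conj_output adj la (rev (t :: L)) (nth tok0 la 0).2 m)
    else ((la, (t :: L, (true, (true, 0)))), [::]).
  rewrite /conj_step /lexed /= -surjective_pairing !nth_rev_cons // e0 e1 L0 /=.
  by rewrite /lex /= L0 -surjective_pairing.
case: ts IH es => [_ es|t' ts IH es].
  by rewrite -es addn1 eqxx /= !cats0 rev_cons -cats1.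
have -> : ((size L).+1 == 2 + 4 * (m * n)) = false.
  by rewrite -es addnS /= eqSS -[X in X == _]addn0 eqn_add2l.
have h0 : nth tok0 (rev (t :: L)) 0 = (true, m) by rewrite nth_rev_cons.
have h1 : nth tok0 (rev (t :: L)) 1 = (true, n) by rewrite nth_rev_cons.
have h2 : size (t :: L) + size (t' :: ts) = 2 + 4 * (m * n).
  by rewrite -es [size (t :: L)]/= addSnnS.
by have := IH (t :: L) (leqW L1) h0 h1 h2 isT; rewrite rev_cons cat_rcons.
Qed.

Lemma transduce_enc_mx d (M : 'M[rat[i]]_d) : 0 < d ->
  transduce g (la, lexer0) (enc_mx M) =
    conj_output adj la (mx_tokens M) (nth tok0 la 0).2 d /\
  transduced g (la, lexer0) (enc_mx M) = (la, lexer0).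
Proof.
move=> d0; rewrite enc_mx_tokens !transduce_cat !transduced_cat.
have [-> ->] := transduce_enc_nat [::] true 0 d.
have -> : g (la, ([::], (false, (true, 0 + d))), false) =
  ((la, ([:: (true, d)], (false, (true, 0)))), [::]) by [].
have [-> ->] := transduce_enc_nat [:: (true, d)] true 0 d.
have -> : g (la, ([:: (true, d)], (false, (true, 0 + d))), false) =
  ((la, ([:: (true, d); (true, d)], (true, (true, 0)))), [::]).
  rewrite /conj_step /lexed /= add0n.
  (* As [d] is positive, the two dimensions alone are not yet a complete code. *)
  by case: eqP => //; case: d d0 {M} => // d _; rewrite mulSn addSn mulnS.
have := @transduce_tokens [:: (true, d);
  (true, d)] d d (entry_tokens M) isT erefl erefl.
rewrite size_entry_tokens muln_gt0 muln_gt0 d0 => /(_ erefl isT).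
by [].
Qed.

End Lexing.

Lemma transduce_stream adj n (A : 'M[rat[i]]_n) (s : nat ->
  'M[rat[i]]_(n * n)) k :
  0 < n ->
  transduce (conj_step adj) (conj_init (rev (enc_mx A)))
    (flatten [seq enc_mx (s i) | i <- iota 0 k]) =
  flatten [seq enc_mx (conj_mx adj A (s i)) | i <- iota 0 k].
Proof.
move=> n0; rewrite conj_init_enc_mx; elim: k 0 => //= k IH j.
rewrite transduce_cat.
have [|-> ->] := @transduce_enc_mx adj (mx_tokens A) _ (s j);
  first by rewrite muln_gt0 n0.
by rewrite IH conj_outputE.
Qed.

(** Every finite part of the new stream is the transduction of a finite part of the old one, and the
    [emits] clause of universality carries it over to [U]. *)
Theorem conj_machine (U : machine) (hU : universal_prefix_machine U) adj :
  exists t, forall n (A : 'M[rat[i]]_n) q (s : nat -> 'M[rat[i]]_(n * n)),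
    0 < n -> outputs_seq U (enc_mx A) q s ->
    outputs_seq U (enc_mx A) (t ++ q) (fun k => conj_mx adj A (s k)).
Proof.
have [T preT hT] := transducer_machine U computable_conj_init
  (computable_conj_step adj).
have [t ht] := hU.2 T preT; exists t => n A q s n0 hs k.
have [_ [h _]] := ht (enc_mx A) [::] q
  (flatten [seq enc_mx (conj_mx adj A (s i)) | i <- iota 0 k]).
by apply: h; rewrite -transduce_stream //; apply: hT; exact: hs.
Qed.

(** * Prepending a word to the output *)

Section OutputPrefix.
Variables (U : machine) (t : seq bool).

(** The first [size t] steps print [t] and leave all tapes unchanged up to trailing blanks; after
    that the steps are those of [U]. *)
Definition output_prefix_delta (st : 'I_(size t).+1 * state U)
    (sc : input_tape + work U -> option bool) :
    option (('I_(size t).+1 * state U) *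
            (input_tape + work U -> option bool * move) * option bool) :=
  let: (i, q) := st in
  if i < size t
  then Some ((inord i.+1, q), fun j => (sc j, Stay), Some (nth false t i))
  else if delta q sc is Some (q', w, o) then Some ((i, q'), w, o) else None.

Definition output_prefix : machine :=
  @Machine ('I_(size t).+1 * state U)%type (work U) (inord 0, start U)
    output_prefix_delta.

Local Notation T := output_prefix.
Local Notation tstep := (fun c : config T => odflt c (step c)).

Definition emitting i (u : config U) (c : config T) : Prop :=
  [/\ cstate c = (inord i, cstate u),
      forall j, tape_eq (ctape c j) (ctape u j)
    & cout c = take i t ++ cout u].

Lemma output_prefix_start a y p i : i <= size t ->
  emitting i (init U a y p) (run T a y p i).
Proof.
elim: i => [|i IH] hi; first by split=> //; rewrite take0.
have [es et eo] := IH (ltnW hi); rewrite /run iterS -/(run T a y p i).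
have iE : (inord i : 'I_(size t).+1) = i :> nat by rewrite inordK // ltnS ltnW.
rewrite /step es /= iE hi /=; split=> //=.
  by move=> j; exact: tape_eq_trans (tape_eq_stay _) (et j).
by rewrite eo !cats0 -take_nth.
Qed.

Lemma output_prefix_none c u : emitting (size t) u c ->
  match step c, step u with
  | None, None => True
  | Some c', Some u' => emitting (size t) u' c'
  | _, _ => False
  end.
Proof.
move=> [es et eo]; rewrite /step es /= inordK // ltnn.
have -> : (fun j => scan (ctape c j)) = (fun j => scan (ctape u j)).
  by apply/funext => j; exact: tape_eq_scan.
case: delta => // -[[q w] o]; split=> //= [j|]; first exact: tape_eq_act.
by case: o => [b|] //; rewrite eo rcons_cat.
Qed.

Lemma output_prefix_run a y p k :
  emitting (size t) (run U a y p k) (run T a y p (k + size t)).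
Proof.
elim: k => [|k IH]; first exact: output_prefix_start.
rewrite /run addSn !iterS -!/(run _ _ _ _ _); have := output_prefix_none IH.
by case: step => [c'|]; case: step.
Qed.

Lemma output_prefix_computes a y p x :
  computes U a y p x -> computes T a y p (t ++ x).
Proof.
move=> [k [h <-]]; exists (k + size t).
have := output_prefix_run a y p k => r; have := output_prefix_none r.
by rewrite h; case: step => // _; case: r => _ _ ->; rewrite take_size.
Qed.

(** The machine halts on no program on which [U] does not, which gives prefix-freeness. It cannot
    halt while printing [t]. *)
Lemma output_prefix_halts a y p x :
  computes T a y p x -> exists x', computes U a y p x'.
Proof.
move=> [k [h _]]; case: (ltnP k (size t)) => hk.
  have [es _ _] := output_prefix_start a y p (ltnW hk).
  have kE : (inord k : 'I_(size t).+1) = k :> nat by rewrite inordK // ltnS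
    ltnW.
  by move: h; rewrite /step es /= kE hk.
have := output_prefix_none (output_prefix_run a y p (k - size t)).
rewrite subnK // h; case E: step => // _.
by exists (cout (run U a y p (k - size t))), (k - size t).
Qed.

Lemma output_prefix_prefix : prefix_machine U -> prefix_machine T.
Proof.
move=> pU a y p s x x' s0 /output_prefix_halts[z hz] /output_prefix_halts[z'].
exact: pU hz.
Qed.

End OutputPrefix.

Lemma universal_output_prefix U (t : seq bool) : universal_prefix_machine U ->
  exists r, forall a y p x, computes U a y p x ->
    computes U a y (r ++ p) (t ++ x).
Proof.
move=> [pU hU]; have [r hr] := hU _ (@output_prefix_prefix U t pU).
exists r => a y p x /(@output_prefix_computes U t) h.
by have [[+ _] _] := hr a y p (t ++ x); apply.
Qed.

Local Open Scope classical_set_scope.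
Local Open Scope ring_scope.
Local Open Scope complex_scope.
Local Open Scope sesquilinear_scope.

(** * Universal probability *)

Section Esum.
Variable R : realType.
Local Open Scope ereal_scope.

Lemma esumZl (T : choiceType) (D : set T) (c : R) (a : T -> \bar R) :
  (0 <= c)%R -> (forall i, 0 <= a i) ->
  \esum_(i in D) (c%:E * a i) = c%:E * \esum_(i in D) a i.
Proof.
move=> c0 a0; rewrite /esum -ereal_supZl //; last first.
  by apply/set0P; exists 0; exists set0;
    [exact: fsets_set0 | rewrite fsbig_set0].
congr ereal_sup; apply/seteqP; split=> x /=.
  move=> [A hA <-]; exists (\sum_(i \in A) a i); first by exists A.
  by rewrite ge0_mule_fsumr.
by move=> [_ [A hA <-] <-]; exists A => //; rewrite ge0_mule_fsumr.
Qed.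

Lemma esum_subset (T : choiceType) (D E : set T) (a : T -> \bar R) :
  D `<=` E -> \esum_(i in D) a i <= \esum_(i in E) a i.
Proof.
move=> DE; apply: ereal_sup_le => _ [A [finA AD] <-].
by exists A => //; split=> // x /AD /DE.
Qed.

(** Used with programs as [k], sorted into fibers by what they compute; determinism makes the fibers
    disjoint. *)
Lemma esum_fibers (I K : choiceType) (E : set I) (J : I -> set K)
    (a : K -> \bar R) :
  (forall i i' k, E i -> E i' -> J i k -> J i' k -> i = i') ->
  (forall k, 0 <= a k) ->
  \esum_(i in E) \esum_(k in J i) a k =
  \esum_(k in [set k | exists2 i, E i & J i k]) a k.
Proof.
move=> dJ a0; rewrite esum_esum //.
rewrite (_ : [set k | _] = snd @` (E `*`` J)); last first.
  apply/seteqP; split=> [k [i Ei Jik]|k [[i k'] [/= Ei Jik] <-]].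
    by exists (i, k).
  by exists i.
rewrite (esum_image _ snd a) // => -[i k] [i' k'].
move=> /set_mem[/= Ei Jik] /set_mem[/= Ei' Jik'] ekk.
by rewrite -ekk in Jik' *; rewrite (dJ i i' k).
Qed.

End Esum.

(** * Kraft's inequality *)

Section Kraft.
Variable R : realType.
Local Notation w2 p := ((2^-1 : R) ^+ size p).

Definition prefix_free (D : set (seq bool)) :=
  forall p s, D p -> D (p ++ s) -> s = [::].

(** Induction on the maximal length. Unless the empty word occurs, and then it is alone, removing
    the first bit splits the words into two prefix-free lists, each entering with weight one
    half. *)
Lemma kraft_seq n (l : seq (seq bool)) : uniq l ->
  (forall p, p \in l -> (size p <= n)%N) -> prefix_free [set p | p \in l] ->
  \sum_(p <- l) w2 p <= 1.
Proof.
have single (l0 : seq (seq bool)) : uniq l0 -> {subset l0 <= [:: [::]]} ->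
    \sum_(p <- l0) w2 p <= 1.
  move=> u0 h; have := uniq_leq_size u0 h.
  case: l0 {u0} h => [|p [|]] // h _; first by rewrite big_nil.
  have := h p; rewrite !inE eqxx => /(_ isT) /eqP ->.
  by rewrite big_seq1 expr0.
elim: n l => [|n IH] l ul sl pl.
  apply: single => // p /sl; rewrite leqn0 size_eq0 => /eqP ->.
  by rewrite inE.
have [l0|l0] := boolP ([::] \in l).
  by apply: single => // p pl'; rewrite inE; apply/eqP; exact: (pl [::] p).
pose part b := [seq behead p | p <- l & head false p == b].
have memP b p : (p \in part b) = ((b :: p) \in l).
  apply/mapP/idP => [[q]|h]; last by exists (b :: p);
    rewrite // mem_filter /= eqxx.
  rewrite mem_filter => /andP[/eqP <- ql ->].
  by case: q ql => [ql|//]; rewrite ql in l0.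
have H b : \sum_(p <- part b) w2 p <= 1.
  apply: IH.
  - rewrite map_inj_in_uniq ?filter_uniq // => p q.
    rewrite !mem_filter => /andP[/eqP hp pl'] /andP[/eqP hq ql].
    case: p hp pl' => [_ h|x p /= -> _]; first by rewrite h in l0.
    case: q hq ql => [_ h|y q /= -> _]; first by rewrite h in l0.
    by move=> ->.
  - by move=> p; rewrite memP => /sl.
  - by move=> p s /=; rewrite !memP => h1 h2; exact: (pl (b :: p) s).
have -> : \sum_(p <- l) w2 p =
    2^-1 * \sum_(p <- part true) w2 p + 2^-1 * \sum_(p <- part false) w2 p.
  have E b : 2^-1 * \sum_(p <- part b) w2 p = \sum_(p <- l | head false p == b)
    w2 p.
    rewrite big_map big_filter big_distrr /=.
    rewrite big_seq_cond [RHS]big_seq_cond; apply: eq_bigr =>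
      -[|x p] /andP[h _].
      by rewrite h in l0.
    by rewrite /= exprS.
  rewrite !E (bigID (fun p => head false p == true)) /=; congr (_ + _).
  by apply: eq_bigl => p; case: head.
by have := H true; have := H false; lra.
Qed.

Lemma kraft (D : set (seq bool)) : prefix_free D ->
  (\esum_(p in D) (w2 p)%:E <= 1)%E.
Proof.
move=> pD; apply: ge_ereal_sup => _ [A [finA AD] <-].
rewrite fsbig_finite //= sumEFin lee_fin.
set l := finmap.enum_fset _.
have memA p : p \in l -> A p by rewrite in_fset_set // inE.
apply: (@kraft_seq (\max_(p <- l) size p)).
- exact: finmap.fset_uniq.
- by move=> p hp; exact: (@leq_bigmax_seq _ l predT size p).
- by move=> p s /= /memA /AD h1 /memA /AD h2; exact: pD h1 h2.
Qed.

End Kraft.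

Section UnivProb.
Variables (R : realType) (U : machine).

Lemma computes_fun a y p x x' :
  computes U a y p x -> computes U a y p x' -> x = x'.
Proof.
have H t k : step (run U a y p t) = None -> run U a y p (k + t) = run U a y p t.
  by move=> h; elim: k => // k IH;
    rewrite addSn /run iterS -/(run U a y p _) IH h.
move=> [t [ht <-]] [t' [ht' <-]]; case: (leqP t t') => h.
  by rewrite -(subnK h) H.
by rewrite -(subnK (ltnW h)) H.
Qed.

Hypothesis pU : prefix_machine U.
Local Open Scope ereal_scope.
Local Notation prob := (univ_prob R U).

Lemma univ_prob_ge0 a x y : 0 <= prob a x y.
Proof. by apply: esum_ge0 => p _; rewrite lee_fin exprn_ge0. Qed.

(** All programs that halt with output in [E] together form one prefix-free set. *)
Lemma univ_prob_total a y (E : set (seq bool)) :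
  \esum_(x in E) prob a x y <= 1.
Proof.
rewrite /univ_prob esum_fibers; last by move=> p; rewrite lee_fin exprn_ge0.
  apply: kraft => p s [x _ hx] [x' _ hx'].
  by apply/eqP/negP => /negP/eqP s0; exact: (pU s0 hx hx').
by move=> x x' p _ _; exact: computes_fun.
Qed.

Lemma univ_prob_le1 a x y : prob a x y <= 1.
Proof.
have := univ_prob_total a y [set x]; rewrite esum_set1 //; exact: univ_prob_ge0.
Qed.

(** Prepending [r] is injective on programs and multiplies each weight by the same factor. *)
Lemma univ_prob_transfer a y x x' (r : seq bool) :
  (forall p, computes U a y p x -> computes U a y (r ++ p) x') ->
  ((2^-1 : R) ^+ size r)%:E * prob a x y <= prob a x' y.
Proof.
move=> h; have p0 (p : seq bool) : 0 <= ((2^-1 : R) ^+ size p)%:E.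
  by rewrite lee_fin exprn_ge0.
rewrite -esumZl ?exprn_ge0 //.
apply: le_trans (esum_subset _ (D :=
  [set r ++ p | p in [set p | computes U a y p x]]) _).
  rewrite (esum_image _ (cat r)).
    by apply: le_esum => p _; rewrite -EFinM -exprD size_cat.
  by move=> p q _ _ /eqP; rewrite eqseq_cat // eqxx => /eqP.
by move=> _ [p hp <-]; exact: h.
Qed.

End UnivProb.

(** * Unique decodability of matrix codes *)

Lemma lex_suffix s w : exists x, (foldl lex s w).1 = x ++ s.1.
Proof.
elim: w s => [|b w IH] s /=; first by exists [::].
have [x ->] := IH (lex s b); rewrite /lex.
case: ifP => _; first by exists x.
by case: b; [exists x | exists (rcons x (s.2.2.1, s.2.2.2)); rewrite cat_rcons].
Qed.

Lemma mx_tokens_inj m n (A B : 'M[rat[i]]_(m, n)) :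
  mx_tokens A = mx_tokens B -> A = B.
Proof.
move=> e; apply/matrixP => i j.
have := tok_entry_rep A i j; rewrite e => -[_ _ ->].
by have [_ _ ->] := tok_entry_rep B i j.
Qed.

(** If one code begins the other, its tokens begin the other's tokens, as lexed tokens are never
    revised. Equal dimensions mean equally many tokens, so the lists coincide. *)
Lemma enc_mx_cat_inj m n (A B : 'M[rat[i]]_(m, n)) w w' :
  enc_mx A ++ w = enc_mx B ++ w' -> A = B.
Proof.
wlog le : A B w w' / (size (enc_mx A) <= size (enc_mx B))%N => [H e|e].
  case: (leqP (size (enc_mx A)) (size (enc_mx B))) => [h|/ltnW h].
    exact: H h e.
  by symmetry; exact: H h (esym e).
have [v ev] : exists v, enc_mx B = enc_mx A ++ v.
  exists (drop (size (enc_mx A)) (enc_mx B)).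
  have := congr1 (take (size (enc_mx A))) e.
  rewrite take_size_cat // takel_cat // => {1}->.
  by rewrite cat_take_drop.
have := lex_enc_mx B; rewrite ev foldl_cat lex_enc_mx => h.
have [x] := lex_suffix (rev (mx_tokens A), (true, (true, 0%N))) v.
rewrite h /= => ex; have := congr1 size ex.
rewrite size_cat !size_rev /= !size_entry_tokens => es.
have x0 : x = [::] by apply: size0nil; lia.
by apply: mx_tokens_inj; rewrite -[LHS]revK -[RHS]revK ex x0.
Qed.

Lemma enc_stream_inj m n (s s' : nat -> 'M[rat[i]]_(m, n)) k j w w' :
  flatten [seq enc_mx (s i) | i <- iota j k] ++ w =
  flatten [seq enc_mx (s' i) | i <- iota j k] ++ w' ->
  forall i, (i < k)%N -> s (j + i)%N = s' (j + i)%N.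
Proof.
elim: k j => // k IH j /=.
rewrite -(catA (enc_mx (s j))) -(catA (enc_mx (s' j))) => e.
have e0 := enc_mx_cat_inj e; move: e; rewrite e0 => /eqP.
rewrite eqseq_cat // eqxx /= => /eqP /IH h [|i] hi; first by rewrite addn0.
by rewrite -addSnnS h.
Qed.

Lemma emits_comparable U a y p w w' : emits U a y p w -> emits U a y p w' ->
  exists v v', w ++ v = w' ++ v'.
Proof.
move=> [t /prefixP[v e]] [t' /prefixP[v' e']].
have H k l : (k <= l)%N ->
  exists x, cout (run U a y p l) = cout (run U a y p k) ++ x.
  move=> kl; rewrite -(subnK kl) /run iterD; exact: run_cout.
case: (leqP t t') => [/H[x]|/ltnW/H[x]]; rewrite e e' -catA => h.
  by exists (v ++ x), v'.
by exists v, (v' ++ x).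
Qed.

Lemma outputs_seq_inj U a d q (s s' : nat -> 'M[rat[i]]_d) :
  outputs_seq U a q s -> outputs_seq U a q s' -> s =1 s'.
Proof.
move=> h h' k; have [v [v' e]] := emits_comparable (h k.+1) (h' k.+1).
exact: (enc_stream_inj e (ltnSn k)).
Qed.

(** * Lower probability *)

Section LowerProb.
Variables (R : realType) (U : machine).
Hypothesis pU : prefix_machine U.

Lemma mx_cvg_unique d (s : nat -> 'M[R[i]]_d) M M' :
  mx_cvg s M -> mx_cvg s M' -> M = M'.
Proof.
move=> h h'; apply/matrixP => i j.
have [h1 h2] := h i j; have [h3 h4] := h' i j.
have e1 : complex.Re (M i j) = complex.Re (M' i j).
  by rewrite -(cvg_lim (@Rhausdorff R) h1); exact: (cvg_lim (@Rhausdorff R) h3).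
have e2 : complex.Im (M i j) = complex.Im (M' i j).
  by rewrite -(cvg_lim (@Rhausdorff R) h2); exact: (cvg_lim (@Rhausdorff R) h4).
by case: (M i j) (M' i j) e1 e2 => [x1 y1] [x2 y2] /= -> ->.
Qed.

(** A program outputs at most one sequence of matrices, which has at most one limit. Distinct
    matrices thus draw their weight from disjoint sets of programs, and the total stays below 1. *)
Lemma lower_computes_fun a d q (M M' : 'M[R[i]]_d) :
  lower_computes U a q M -> lower_computes U a q M' -> M = M'.
Proof.
move=> [_ [s [hs _ _ cs]]] [_ [s' [hs' _ _ cs']]].
have e : s = s' by apply/funext; exact: outputs_seq_inj hs hs'.
by rewrite -e in cs'; exact: mx_cvg_unique cs cs'.
Qed.

Local Open Scope ereal_scope.

Lemma lower_prob_ge0 a d (M : 'M[R[i]]_d) y : 0 <= lower_prob U a M y.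
Proof. by apply: esum_ge0 => q _; exact: univ_prob_ge0. Qed.

Lemma lower_prob_total a d (E : set 'M[R[i]]_d) y :
  \esum_(M in E) lower_prob U a M y <= 1.
Proof.
rewrite /lower_prob esum_fibers; last by move=> q; exact: univ_prob_ge0.
  exact: univ_prob_total.
by move=> M M' q _ _; exact: lower_computes_fun.
Qed.

Lemma lower_prob_le1 a d (M : 'M[R[i]]_d) y : lower_prob U a M y <= 1.
Proof.
have := lower_prob_total a [set M] y; rewrite esum_set1 //.
exact: lower_prob_ge0.
Qed.

Lemma lower_prob_transfer a d (M M' : 'M[R[i]]_d) y (t r : seq bool) :
  (forall q, lower_computes U a q M -> lower_computes U a (t ++ q) M') ->
  (forall p x, computes U a y p x -> computes U a y (r ++ p) (t ++ x)) ->
  ((2^-1 : R) ^+ size r)%:E * lower_prob U a M y <= lower_prob U a M' y.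
Proof.
move=> h1 h2; have p0 q : 0 <= univ_prob R U a q y by exact: univ_prob_ge0.
rewrite -esumZl ?exprn_ge0 //.
apply: le_trans (esum_subset _
    (D := [set t ++ q | q in [set q | lower_computes U a q M]]) _).
  rewrite (esum_image _ (cat t)).
    apply: le_esum => q _; apply: univ_prob_transfer => p; exact: h2.
  by move=> p q _ _ /eqP; rewrite eqseq_cat // eqxx => /eqP.
by move=> _ [q hq <-]; exact: h1.
Qed.

End LowerProb.

(** * Absolutely summable families *)

Section Rsum.
Variables (R : realType) (T : choiceType) (D : set T).
Implicit Types f g : T -> R.

Definition rsummable f := summable D (fun x => (f x)%:E).

Lemma nneg_rsummable_fin f : (forall x, 0 <= f x) -> rsummable f ->
  \esum_(x in D) (f x)%:E \is a fin_num.
Proof.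
move=> f0; rewrite /rsummable summableE.
by rewrite (eq_esum (b := fun x => (f x)%:E)) // => x _; rewrite /= ger0_norm.
Qed.

Lemma rsummable_le f g : (forall x, D x -> `|f x| <= g x) -> rsummable g ->
  rsummable f.
Proof.
move=> fg; apply: le_lt_trans; apply: le_esum => x Dx /=.
by rewrite lee_fin (le_trans (fg x Dx)) // ler_norm.
Qed.

Lemma rsummableD f g : rsummable f -> rsummable g ->
  rsummable (fun x => f x + g x).
Proof. by move=> hf hg; exact: (summableD hf hg). Qed.

Lemma rsummableZ c f : rsummable f -> rsummable (fun x => c * f x).
Proof.
rewrite /rsummable /summable => hf.
rewrite (eq_esum (b := fun x => (`|c|%:E * `|(f x)%:E|)%E)).
  rewrite esumZl //; move: hf; rewrite -ge0_fin_numE; last exact: esum_ge0.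
  by move=> /fineK <-; rewrite -EFinM ltry.
by move=> x _; rewrite /= normrM EFinM.
Qed.

(** Any splitting into nonnegative summable parts computes [rsum], not just the positive and
    negative parts. Linearity follows, since those parts are not additive themselves. *)
Lemma rsum_sub f g : (forall x, 0 <= f x) -> (forall x, 0 <= g x) ->
  rsummable f -> rsummable g ->
  rsum D (fun x => f x - g x) =
  fine (\esum_(x in D) (f x)%:E) - fine (\esum_(x in D) (g x)%:E).
Proof.
move=> f0 g0 sf sg; have := esumB sf sg (fun x _ => f0 x) (fun x _ => g0 x).
have sfg : rsummable (fun x => f x - g x) by exact: (summableB sf sg).
rewrite /rsum => e; rewrite -!fineB ?nneg_rsummable_fin //; first by rewrite -e.
- have := summable_funepos sfg; rewrite summableE.
  by rewrite (eq_esum (b := (fun z => (f z - g z)%:E)^\+)%E) // => x _;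
    rewrite gee0_abs.
- have := summable_funeneg sfg; rewrite summableE.
  by rewrite (eq_esum (b := (fun z => (f z - g z)%:E)^\-)%E) // => x _;
    rewrite gee0_abs.
Qed.

Lemma rsum_eq f g : (forall x, D x -> f x = g x) -> rsum D f = rsum D g.
Proof.
move=> h; rewrite /rsum; congr (fine _ - fine _); apply: eq_esum => x Dx.
  by rewrite !funeposE h.
by rewrite !funenegE h.
Qed.

Let pos f x := Num.max (f x) 0.
Let neg f x := Num.max (- f x) 0.

Let pos_ge0 f x : 0 <= pos f x. Proof. by rewrite le_max lexx orbT. Qed.
Let neg_ge0 f x : 0 <= neg f x. Proof. by rewrite le_max lexx orbT. Qed.

Let posBneg f x : f x = pos f x - neg f x.
Proof.
rewrite /pos /neg; case: (leP 0 (f x)) => h.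
  by rewrite max_r ?oppr_le0 // subr0.
by rewrite max_l ?oppr_ge0 ?ltW // sub0r opprK.
Qed.

Let sum_pos f : rsummable f -> rsummable (pos f).
Proof.
rewrite /rsummable /summable; apply: le_lt_trans; apply: le_esum => x _ /=.
rewrite lee_fin /pos ger0_norm ?le_max ?lexx ?orbT // ge_max normr_ge0 andbT.
exact: ler_norm.
Qed.

Let sum_neg f : rsummable f -> rsummable (neg f).
Proof.
rewrite /rsummable /summable; apply: le_lt_trans; apply: le_esum => x _ /=.
rewrite lee_fin /neg ger0_norm ?le_max ?lexx ?orbT // ge_max normr_ge0 andbT.
by rewrite -normrN; exact: ler_norm.
Qed.

Let rsum_pos_neg f : rsummable f -> rsum D f =
  fine (\esum_(x in D) (pos f x)%:E) - fine (\esum_(x in D) (neg f x)%:E).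
Proof.
move=> sf; rewrite -rsum_sub //; [|exact: sum_pos|exact: sum_neg].
by apply: rsum_eq => x _; exact: posBneg.
Qed.

Lemma rsumD f g : rsummable f -> rsummable g ->
  rsum D (fun x => f x + g x) = rsum D f + rsum D g.
Proof.
move=> sf sg; rewrite (@rsum_eq _ (fun x =>
    (pos f x + pos g x) - (neg f x + neg g x))); last first.
  by move=> x _; rewrite {1}(posBneg f) {1}(posBneg g); ring.
have [pf nf] := (sum_pos sf, sum_neg sf); have [pg ng] :=
  (sum_pos sg, sum_neg sg).
have [sp sn] := (rsummableD pf pg, rsummableD nf ng).
have pp x : 0 <= pos f x + pos g x by rewrite addr_ge0.
have nn x : 0 <= neg f x + neg g x by rewrite addr_ge0.
rewrite rsum_sub // (rsum_pos_neg sf) (rsum_pos_neg sg).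
have E (a b : T -> R) : (forall x, 0 <= a x) -> (forall x, 0 <= b x) ->
    rsummable a -> rsummable b ->
    fine (\esum_(x in D) (a x + b x)%:E) =
    fine (\esum_(x in D) (a x)%:E) + fine (\esum_(x in D) (b x)%:E).
  move=> a0 b0 sa sb; rewrite -fineD ?nneg_rsummable_fin //.
  have [a0' b0'] : (forall x, D x -> 0 <= (a x)%:E)%E /\
      (forall x, D x -> 0 <= (b x)%:E)%E by split=> x _; rewrite lee_fin.
  by rewrite -esumD.
by rewrite (E (pos f) (pos g)) // (E (neg f) (neg g)) //; ring.
Qed.

Lemma rsumZ c f : rsummable f -> rsum D (fun x => c * f x) = c * rsum D f.
Proof.
move=> sf.
have E (k : R) (a : T -> R) : 0 <= k -> (forall x, 0 <= a x) ->
    fine (\esum_(x in D) (k * a x)%:E) = k * fine (\esum_(x in D) (a x)%:E).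
  move=> k0 a0; under eq_esum do rewrite EFinM.
  rewrite esumZl // ; have : (0 <= \esum_(i in D) (a i)%:E)%E by apply:
    esum_ge0 => x _; rewrite lee_fin.
  (* If the sum is infinite, both sides are 0, the value of [fine] at [+oo]. *)
  case: (\esum_(i in D) _) => [r| |] //= _.
  have [->|k1] := eqVneq k 0; first by rewrite mul0e mul0r.
  by rewrite mulry gtr0_sg ?lt_neqAle 1?eq_sym ?k1 // mul1e mulr0.
rewrite (rsum_pos_neg sf); case: (leP 0 c) => c0.
  rewrite (@rsum_eq _ (fun x => c * pos f x - c * neg f x)); last first.
    by move=> x _; rewrite {1}(posBneg f) mulrBr.
  have [pf nf] := (rsummableZ c (sum_pos sf), rsummableZ c (sum_neg sf)).
  have pp x : 0 <= c * pos f x by rewrite mulr_ge0.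
  have nn x : 0 <= c * neg f x by rewrite mulr_ge0.
  by rewrite rsum_sub // (E c (pos f)) // (E c (neg f)) // mulrBr.
(* A negative factor exchanges the roles of the positive and negative parts. *)
have c0' : 0 <= - c by rewrite oppr_ge0 ltW.
rewrite (@rsum_eq _ (fun x => - c * neg f x - - c * pos f x)); last first.
  by move=> x _; rewrite {1}(posBneg f); ring.
have [pf nf] := (rsummableZ (- c) (sum_pos sf), rsummableZ (- c) (sum_neg sf)).
have pp x : 0 <= - c * pos f x by rewrite mulr_ge0.
have nn x : 0 <= - c * neg f x by rewrite mulr_ge0.
by rewrite rsum_sub // (E (- c) (pos f)) // (E (- c) (neg f)) //; ring.
Qed.

Lemma rsum_nneg f : (forall x, D x -> 0 <= f x) ->
  rsum D f = fine (\esum_(x in D) (f x)%:E).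
Proof.
move=> f0; rewrite /rsum [X in _ - fine X]esum1 ?subr0.
  by congr fine; apply: eq_esum => x Dx; rewrite funeposE max_l // lee_fin f0.
by move=> x Dx; rewrite funenegE max_r // -EFinN lee_fin oppr_le0 f0.
Qed.

Lemma rsum0 : rsum D (fun=> 0 : R) = 0.
Proof. by rewrite rsum_nneg // (esum1 (D := D) (a := fun=> 0%:E)). Qed.

Lemma rsummable0 : rsummable (fun=> 0).
Proof. by rewrite /rsummable /summable esum1 // => x _; rewrite /= normr0. Qed.

Lemma rsummable_sum (I : Type) (r : seq I) (F : I -> T -> R) :
  (forall i, rsummable (F i)) -> rsummable (fun x => \sum_(i <- r) F i x).
Proof.
move=> h; elim: r => [|i r IH].
  by apply: rsummable_le rsummable0 => x _; rewrite big_nil normr0.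
apply: (@rsummable_le _ (fun x => `|F i x| + `|\sum_(j <- r) F j x|)).
  by move=> x _; rewrite big_cons ler_normD.
have sumN f : rsummable f -> rsummable (fun x => `|f x|).
  by rewrite /rsummable /summable;
    under eq_esum do rewrite /= -[X in X%:E]normr_id.
by apply: rsummableD; exact: sumN.
Qed.

Lemma rsum_sum (I : Type) (r : seq I) (F : I -> T -> R) :
  (forall i, rsummable (F i)) ->
  rsum D (fun x => \sum_(i <- r) F i x) = \sum_(i <- r) rsum D (F i).
Proof.
move=> h; elim: r => [|i r IH].
  rewrite big_nil -[RHS]rsum0; apply: rsum_eq => x _; exact: big_nil.
rewrite big_cons -IH -rsumD //; last exact: rsummable_sum.
by apply: rsum_eq => x _; rewrite big_cons.
Qed.

End Rsum.

(** * Positive semidefinite matrices *)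

Section Psd.
Variable R : realType.
Local Notation C := R[i].

Lemma psd_diag d (M : 'M[C]_d) i : psd M -> 0 <= M i i.
Proof.
move=> /(_ (delta_mx i ord0)); rewrite -mulmxA.
rewrite trmx_delta map_delta_mx -rowE -colE.
by rewrite !mxE.
Qed.

(** The quadratic form at a combination of two basis vectors. Taking [c] among 1, -1, ['i] and
    [- 'i] gives access to single entries by polarization. *)
Lemma psd_pair d (M : 'M[C]_d) i j (c : C) : psd M ->
  0 <= M i i + c * M i j + conjc c * M j i + conjc c * c * M j j.
Proof.
move=> /(_ (delta_mx i ord0 + c *: delta_mx j ord0)).
set u := delta_mx i ord0; set v := delta_mx j ord0.
have -> : (u + c *: v) ^t* = u ^t* + conjc c *: v ^t*.
  by apply/matrixP => k l; rewrite !mxE rmorphD rmorphM.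
rewrite /u /v !trmx_delta !map_delta_mx !mulmxDl !mulmxDr.
rewrite -!scalemxAl -!scalemxAr -!rowE -!colE !mxE.
by rewrite -!addrA !mulrA addrCA.
Qed.

Lemma psd_conj_sym d (M : 'M[C]_d) i j : psd M -> M j i = conjc (M i j).
Proof.
move=> pM; have := psd_pair i j 1 pM; have := psd_pair i j 'i pM.
have := psd_diag i pM; have := psd_diag j pM.
case: (M i i) (M j j) (M i j) (M j i) => [a a'] [b b'] [x x'] [y y'].
rewrite !lecE /=.
move=> /andP[/eqP h1 _] /andP[/eqP h2 _] /andP[/eqP h3 _] /andP[/eqP h4 _].
by congr Complex; move: h1 h2 h3 h4 => /=; lra.
Qed.

Lemma psd_entry d (M : 'M[C]_d) i j : psd M ->
  `|complex.Re (M i j)| <= complex.Re (M i i) + complex.Re (M j j) /\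
  `|complex.Im (M i j)| <= complex.Re (M i i) + complex.Re (M j j).
Proof.
move=> pM; have := psd_conj_sym i j pM.
have := psd_pair i j 1 pM; have := psd_pair i j 'i pM.
have := psd_pair i j (-1) pM; have := psd_pair i j (- 'i) pM.
have := psd_diag i pM; have := psd_diag j pM.
case: (M i i) (M j j) (M i j) (M j i) => [a a'] [b b'] [x x'] [y y'].
rewrite !lecE /=.
move=> /andP[_ h1] /andP[_ h2] /andP[_ h3] /andP[_ h4] /andP[_ h5] /andP[_ h6]
  [e1 e2].
by rewrite !ler_norml; split; apply/andP; split; lra.
Qed.

Lemma Re_sum (I : Type) (r : seq I) (P : pred I) (F : I -> C) :
  complex.Re (\sum_(i <- r | P i) F i) = \sum_(i <- r | P i) complex.Re (F i).
Proof. exact: (raddf_sum (@complex.Re R : Rcomplex R -> R)). Qed.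

Lemma Im_sum (I : Type) (r : seq I) (P : pred I) (F : I -> C) :
  complex.Im (\sum_(i <- r | P i) F i) = \sum_(i <- r | P i) complex.Im (F i).
Proof. exact: (raddf_sum (@complex.Im R : Rcomplex R -> R)). Qed.

(** The trace bounds each diagonal entry by 1, and [psd_entry] adds two of them. A uniform bound is
    the aim, for summability of mixtures. *)
Lemma semi_density_entry d (M : 'M[C]_d) i j : semi_density M ->
  `|complex.Re (M i j)| <= 2 /\ `|complex.Im (M i j)| <= 2.
Proof.
move=> [pM tM].
have D k : complex.Re (M k k) <= 1.
  move: tM; rewrite lecE => /andP[_]; rewrite /mxtrace Re_sum (bigD1 k) //=.
  apply: le_trans; rewrite lerDl; apply: sumr_ge0 => l _.
  by have := psd_diag l pM; rewrite lecE => /andP[].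
have [h1 h2] := psd_entry i j pM; have := D i; have := D j.
by split; [apply: le_trans h1 _ | apply: le_trans h2 _]; lra.
Qed.

Lemma trmxC_mul m n p (A : 'M[C]_(m, n)) (B : 'M[C]_(n, p)) :
  (A *m B) ^t* = B ^t* *m A ^t*.
Proof. by rewrite trmx_mul map_mxM. Qed.

Lemma psd_conjmx d e (M : 'M[C]_d) (B : 'M[C]_(d, e)) :
  psd M -> psd (B ^t* *m M *m B).
Proof.
by move=> pM v; have := pM (B *m v); rewrite trmxC_mul !mulmxA.
Qed.

Lemma psd_gram d e (X : 'M[C]_(d, e)) : psd (X ^t* *m X).
Proof.
move=> v; rewrite !mulmxA -trmxC_mul -mulmxA mxE; apply: sumr_ge0 => i _.
by rewrite !mxE mulrC mul_conjC_ge0.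
Qed.

Lemma psd_hermsym d (M : 'M[C]_d) : psd M -> M \is hermsymmx.
Proof.
move=> pM; apply/is_hermitianmxP; rewrite expr0 scale1r.
by apply/matrixP => i j; rewrite !mxE (psd_conj_sym j i pM).
Qed.

(** The spectral theorem for normal matrices; the eigenvalues are diagonal entries of a unitary
    conjugate, which is again positive semidefinite. *)
Lemma psd_spectral d (P : 'M[C]_d) : psd P ->
  exists V : 'M[C]_d, exists l : 'rV[C]_d,
  [/\ V \is unitarymx, forall i, 0 <= l 0 i & P = V ^t* *m diag_mx l *m V].
Proof.
move=> pP; have /hermitian_normalmx /orthomx_spectralP e := psd_hermsym pP.
have hV := spectral_unitarymx P; rewrite (invmx_unitary hV) in e.
exists (spectralmx P), (spectral_diag P); split=> // i.
have -> : spectral_diag P 0 i =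
    ((spectralmx P ^t*) ^t* *m P *m spectralmx P ^t*) i i.
  rewrite [X in _ *m X *m _]e trmxCK !mulmxA mulmxtVK // (unitarymxP hV).
  by rewrite mul1mx mxE eqxx mulr1n.
exact/psd_diag/psd_conjmx.
Qed.

Lemma psd_factor d (P : 'M[C]_d) : psd P -> exists X : 'M[C]_d, P = X ^t* *m X.
Proof.
move=> /psd_spectral[V [l [_ l0 ->]]].
exists (diag_mx (\row_i sqrtC (l 0 i)) *m V).
rewrite trmxC_mul -!mulmxA; congr (_ *m _); rewrite mulmxA; congr (_ *m _).
rewrite tr_diag_mx map_diag_mx mulmx_diag; congr diag_mx.
apply/rowP => i; rewrite !mxE.
have h : sqrtC (l 0 i) \is Num.real by rewrite ger0_real // sqrtC_ge0.
by rewrite [X in X * _](conj_Creal h) -expr2 sqrtCK.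
Qed.

Lemma mxtrace_unitary_conj d (V P : 'M[C]_d) : V \is unitarymx ->
  \tr (V ^t* *m P *m V) = \tr P.
Proof.
move=> hV; rewrite mxtrace_mulC mulmxA (unitarymxP hV) mul1mx.
by [].
Qed.

(** In an eigenbasis of [Q] the trace is a sum of diagonal entries of the rotated [P] times
    eigenvalues of [Q], and each eigenvalue is at most the trace of [Q]. *)
Lemma psd_trace_mul d (P Q : 'M[C]_d) : psd P -> psd Q ->
  0 <= \tr (P *m Q) <= \tr P * \tr Q.
Proof.
move=> pP /psd_spectral[V [l [hV l0 ->]]].
have hW : V ^t* \is unitarymx by rewrite trmxC_unitary.
pose K := (V ^t*) ^t* *m P *m V ^t*.
have pK : psd K by exact: psd_conjmx.
have -> : \tr (P *m (V ^t* *m diag_mx l *m V)) = \sum_i K i i * l 0 i.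
  rewrite !mulmxA mxtrace_mulC !mulmxA -{1}[V]trmxCK -/K mul_mx_diag.
  by apply: eq_bigr => i _; rewrite mxE.
rewrite (mxtrace_unitary_conj _ hV) -(mxtrace_unitary_conj P hW) -/K
  mxtrace_diag.
rewrite sumr_ge0 /=; last by move=> i _; rewrite mulr_ge0 // psd_diag.
rewrite [\tr K]/mxtrace mulr_suml; apply: ler_sum => i _.
apply: ler_wpM2l; first exact: psd_diag.
by rewrite (bigD1 i) //= lerDl sumr_ge0.
Qed.

End Psd.

(** * Kronecker products *)

Section Tprod.
Variable F : fieldType.

Lemma trow_entry n1 m2 n2 (A : 'rV[F]_n1) (B : 'M[F]_(m2, n2)) i
    (j : 'I_(n1 * n2)) (j1 : 'I_n1) (j2 : 'I_n2) :
  j = (j1 * n2 + j2)%N :> nat -> trow A B i j = A 0 j1 * B i j2.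
Proof.
elim: n1 A j j1 => [|n1 IH] A j j1; first by case: j1.
move=> e; rewrite /= mxE; case: splitP => k ek; rewrite ek in e.
  have j10 : j1 = ord0.
    by apply: val_inj => /=; case: (val j1) e (ltn_ord k) => // x;
      rewrite mulSn -addnA => ->; rewrite ltnNge leq_addr.
  have -> : k = j2 by apply: val_inj; rewrite /= e j10.
  by rewrite !mxE j10; congr (A _ _ * _); apply: val_inj.
case: (unliftP ord0 j1) => [j1' ej|ej]; last first.
  by move: e; rewrite ej /= mul0n add0n => e; have := ltn_ord j2;
    rewrite -e ltnNge leq_addr.
rewrite (IH _ _ j1') ?mxE; last first.
  by move: e; rewrite ej lift0 mulSn -addnA => /addnI.
by rewrite ej; congr (A _ _ * _); apply: val_inj.
Qed.

(** [tprod] is defined by recursion on blocks; the recursion unrolls to the usual entries with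
    row-major pairs of indices. *)
Lemma tprod_entry m1 n1 m2 n2 (A : 'M[F]_(m1, n1)) (B : 'M[F]_(m2, n2))
    (i : 'I_(m1 * m2)) (j : 'I_(n1 * n2)) (i1 : 'I_m1) (i2 : 'I_m2) (j1 :
      'I_n1) (j2 : 'I_n2) :
  i = (i1 * m2 + i2)%N :> nat -> j = (j1 * n2 + j2)%N :> nat ->
  tprod A B i j = A i1 j1 * B i2 j2.
Proof.
elim: m1 A i i1 => [|m1 IH] A i i1; first by case: i1.
move=> e ej; rewrite /= mxE; case: splitP => k ek; rewrite ek in e.
  have i10 : i1 = ord0.
    by apply: val_inj => /=; case: (val i1) e (ltn_ord k) => // x;
      rewrite mulSn -addnA => ->; rewrite ltnNge leq_addr.
  have -> : k = i2 by apply: val_inj; rewrite /= e i10.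
  by rewrite (trow_entry _ _ _ ej) mxE i10; congr (A _ _ * _); apply: val_inj.
case: (unliftP ord0 i1) => [i1' ei|ei]; last first.
  by move: e; rewrite ei /= mul0n add0n => e; have := ltn_ord i2;
    rewrite -e ltnNge leq_addr.
rewrite (IH _ _ i1') ?mxE //; last first.
  by move: e; rewrite ei lift0 mulSn -addnA => /addnI.
by rewrite ei; congr (A _ _ * _); apply: val_inj.
Qed.

Lemma ord_mul_split m1 m2 (i : 'I_(m1 * m2)) :
  exists (i1 : 'I_m1) (i2 : 'I_m2), i = (i1 * m2 + i2)%N :> nat.
Proof.
have m20 : (0 < m2)%N by case: m2 i => // -[]; rewrite muln0.
have h1 : (i %/ m2 < m1)%N by rewrite ltn_divLR.
have h2 : (i %% m2 < m2)%N by rewrite ltn_mod.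
by exists (Ordinal h1), (Ordinal h2); exact: divn_eq.
Qed.

End Tprod.

Section TprodPsd.
Variable R : realType.
Local Notation C := R[i].

Lemma tprod_trmxC m1 n1 m2 n2 (A : 'M[C]_(m1, n1)) (B : 'M[C]_(m2, n2)) :
  (tprod A B) ^t* = tprod (A ^t*) (B ^t*).
Proof.
apply/matrixP => i j; have [i1 [i2 ei]] := ord_mul_split i.
have [j1 [j2 ej]] := ord_mul_split j.
by rewrite !mxE (tprod_entry _ _ ei ej) (tprod_entry _ _ ej ei) !mxE rmorphM.
Qed.

(** A Kronecker product of Gram matrices is the Gram matrix of the Kronecker product. *)
Lemma psd_tprod d e (P : 'M[C]_d) (Q : 'M[C]_e) :
  psd P -> psd Q -> psd (tprod P Q).
Proof.
move=> /psd_factor[X ->] /psd_factor[Y ->]; rewrite tprodE -tprod_trmxC.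
exact: psd_gram.
Qed.

End TprodPsd.

(** * Mixtures of semi-density matrices *)

Section Mixture.
Variables (R : realType) (T : choiceType) (D : set T) (d : nat).
Variables (w : T -> R) (G : T -> 'M[R[i]]_d).
Hypothesis w0 : forall x, 0 <= w x.
Hypothesis w1 : (\esum_(x in D) (w x)%:E <= 1)%E.
Hypothesis sG : forall x, D x -> semi_density (G x).

Local Notation mix := (mx_sum D (fun x => (w x)%:C *: G x)).

Lemma mixture_weight_rsummable : rsummable D w.
Proof.
rewrite /rsummable /summable (eq_esum (b := fun x => (w x)%:E)).
  by apply: le_lt_trans w1 _; exact: ltry.
by move=> x _; rewrite /= ger0_norm.
Qed.

Lemma mixture_entry_rsummable i j :
  rsummable D (fun x => w x * complex.Re (G x i j)) /\
  rsummable D (fun x => w x * complex.Im (G x i j)).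
Proof.
have h2 := rsummableZ 2 mixture_weight_rsummable.
split; apply: rsummable_le h2 => x Dx; have [hr hi] :=
  semi_density_entry i j (sG Dx).
  by rewrite normrM (ger0_norm (w0 x)) mulrC ler_wpM2r.
by rewrite normrM (ger0_norm (w0 x)) mulrC ler_wpM2r.
Qed.

(** For fixed [K] the trace is a finite real-linear combination of real and imaginary parts of
    entries, each of them a summable family. *)
Lemma mixture_trace (K : 'M[R[i]]_d) : \tr (mix *m K) =
  rsum D (fun x => w x * complex.Re (\tr (G x *m K))) +i*
  rsum D (fun x => w x * complex.Im (\tr (G x *m K))).
Proof.
have trE (M : 'M[R[i]]_d) : \tr (M *m K) = \sum_i \sum_j M i j * K j i.
  by apply: eq_bigr => i _; rewrite mxE.
have re i j := (mixture_entry_rsummable i j).1.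
have im i j := (mixture_entry_rsummable i j).2.
have mixE i j : mix i j = rsum D (fun x => w x * complex.Re (G x i j)) +i*
    rsum D (fun x => w x * complex.Im (G x i j)).
  rewrite mxE; congr Complex; apply: rsum_eq => x _; rewrite mxE.
    by case: (G x i j) => u v; rewrite /= mul0r subr0.
  by case: (G x i j) => u v; rewrite /= mul0r addr0.
have scaled := @rsummableZ R T D.
apply/eqP; rewrite eq_complex !trE !Re_sum !Im_sum /=; apply/andP; split;
  apply/eqP.
- rewrite (@rsum_eq _ _ _ _ (fun x => \sum_i \sum_j
      (complex.Re (K j i) * (w x * complex.Re (G x i j)) +
       - complex.Im (K j i) * (w x * complex.Im (G x i j))))); last first.
    move=> x _; rewrite trE Re_sum mulr_sumr; apply: eq_bigr => i _.
    rewrite Re_sum mulr_sumr; apply: eq_bigr => j _.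
    by case: (G x i j) (K j i) => [u v] [u' v'] /=; ring.
  rewrite rsum_sum => [|i]; last first.
    by apply: rsummable_sum => j; apply: rsummableD; exact: scaled.
  apply: eq_bigr => i _; rewrite Re_sum rsum_sum => [|j]; last first.
    by apply: rsummableD; exact: scaled.
  apply: eq_bigr => j _; rewrite rsumD ?rsumZ //; try exact: scaled.
  by rewrite mixE; case: (K j i) => u v /=; ring.
- rewrite (@rsum_eq _ _ _ _ (fun x => \sum_i \sum_j
      (complex.Im (K j i) * (w x * complex.Re (G x i j)) +
       complex.Re (K j i) * (w x * complex.Im (G x i j))))); last first.
    move=> x _; rewrite trE Im_sum mulr_sumr; apply: eq_bigr => i _.
    rewrite Im_sum mulr_sumr; apply: eq_bigr => j _.
    by case: (G x i j) (K j i) => [u v] [u' v'] /=; ring.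
  rewrite rsum_sum => [|i]; last first.
    by apply: rsummable_sum => j; apply: rsummableD; exact: scaled.
  apply: eq_bigr => i _; rewrite Im_sum rsum_sum => [|j]; last first.
    by apply: rsummableD; exact: scaled.
  apply: eq_bigr => j _; rewrite rsumD ?rsumZ //; try exact: scaled.
  by rewrite mixE; case: (K j i) => u v /=; ring.
Qed.

(** Against a positive semidefinite [K] all terms are real and nonnegative, so the signed sum
    becomes an [esum], which is monotone. *)
Lemma mixture_trace_psd (K : 'M[R[i]]_d) : psd K ->
  \tr (mix *m K) =
  (fine (\esum_(x in D) (w x * complex.Re (\tr (G x *m K)))%:E))%:C.
Proof.
move=> pK; rewrite mixture_trace.
have h x : D x -> 0 <= complex.Re (\tr (G x *m K)) /\ complex.Im (\tr (G x *m
  K)) = 0.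
  move=> /sG[pG _]; have /andP[+ _] := psd_trace_mul pG pK.
  by rewrite lecE => /andP[/eqP -> ->].
congr Complex; first by rewrite rsum_nneg // => x /h[h1 _]; rewrite mulr_ge0.
by rewrite -[RHS](rsum0 R D); apply: rsum_eq => x /h[_ ->]; rewrite mulr0.
Qed.

Lemma psd_rank1 (v : 'cV[R[i]]_d) : psd (v *m v ^t*).
Proof. by have := psd_gram (v ^t*); rewrite trmxCK. Qed.

Lemma psd1 : psd (1%:M : 'M[R[i]]_d).
Proof. by have := psd_gram (1%:M : 'M[R[i]]_d);
  rewrite trmx1 map_mx1 mulmx1. Qed.

Lemma mixture_semi_density : semi_density mix.
Proof.
split.
  (* The quadratic form at [v] is the trace against the rank one matrix of [v]. *)
  move=> v; have -> : (v ^t* *m mix *m v) ord0 ord0 = \tr (mix *m (v *m v ^t*)).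
    by rewrite mulmxA mxtrace_mulC mulmxA trace_mx11.
  rewrite mixture_trace_psd; last exact: psd_rank1.
  rewrite ler0c fine_ge0 //; apply: esum_ge0 => x Dx;
    rewrite lee_fin mulr_ge0 //.
  have /andP[+ _] := psd_trace_mul (sG Dx).1 (psd_rank1 v).
  by rewrite lecE => /andP[].
rewrite -[mix]mulmx1 mixture_trace_psd; last exact: psd1.
rewrite -[1]/(1%:C) lecR.
have le1 : (\esum_(x in D) (w x * complex.Re (\tr (G x *m 1%:M)))%:E <= 1)%E.
  apply: le_trans w1; apply: le_esum => x Dx; rewrite lee_fin mulmx1.
  have [_ +] := sG Dx; rewrite lecE => /andP[_ h].
  by rewrite ler_piMr.
have ge0 : (0 <= \esum_(x in D) (w x * complex.Re (\tr (G x *m 1%:M)))%:E)%E.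
  apply: esum_ge0 => x Dx; rewrite lee_fin mulr_ge0 //.
  have /andP[+ _] := psd_trace_mul (sG Dx).1 psd1.
  by rewrite lecE => /andP[].
by move: ge0 le1; case: (\esum_(x in D) _) => //= r _; rewrite lee_fin.
Qed.

End Mixture.

(** * Elementary matrices and lower computation *)

Section Elem.
Variable R : realType.
Local Notation C := R[i].

Definition elem_cplx (z : rat[i]) : C :=
  ratr (complex.Re z) +i* ratr (complex.Im z).

Lemma elemE m n (A : 'M[rat[i]]_(m, n)) i j : elem R A i j = elem_cplx (A i j).
Proof. by rewrite mxE. Qed.

Lemma elem_cplxD z z' : elem_cplx (z + z') = elem_cplx z + elem_cplx z'.
Proof. by case: z z' => [a b] [c e]; rewrite /elem_cplx /= !rmorphD. Qed.

Lemma elem_cplx0 : elem_cplx 0 = 0.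
Proof. by rewrite /elem_cplx /= rmorph0. Qed.

Lemma elem_cplxM z z' : elem_cplx (z * z') = elem_cplx z * elem_cplx z'.
Proof.
case: z z' => [a b] [c e]; rewrite /elem_cplx /=.
by rewrite rmorphB rmorphD !rmorphM.
Qed.

Lemma elem_cplxJ z : elem_cplx (conjc z) = conjc (elem_cplx z).
Proof. by case: z => [a b]; rewrite /elem_cplx /= rmorphN. Qed.

Lemma elem_cplx_sum (I : Type) (r : seq I) (F : I -> rat[i]) :
  elem_cplx (\sum_(i <- r) F i) = \sum_(i <- r) elem_cplx (F i).
Proof. exact: (big_morph _ elem_cplxD elem_cplx0). Qed.

Lemma elem_conj_mx adj n (A : 'M[rat[i]]_n) M :
  elem R (conj_mx adj A M) =
  (elem R (tensor_mx adj A)) ^t* *m elem R M *m elem R (tensor_mx adj A).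
Proof.
apply/matrixP => i j; rewrite elemE mxE elem_cplx_sum mxE.
under [RHS]eq_bigr => l _ do rewrite mxE mulr_suml.
rewrite [RHS]exchange_big /=; apply: eq_bigr => k _.
rewrite elem_cplx_sum; apply: eq_bigr => l _.
rewrite !elem_cplxM elem_cplxJ -!elemE; congr (_ * _ * _).
by rewrite !mxE.
Qed.

Lemma elem_tensor_mx n (A : 'M[rat[i]]_n) :
  elem R (tensor_mx false A) = tprod (elem R A) 1%:M /\
  elem R (tensor_mx true A) = (tprod (elem R A) 1%:M) ^t*.
Proof.
have H (i j : 'I_(n * n)) : tprod (elem R A) 1%:M i j =
    if (i %% n == j %% n)%N then elem_cplx (A (divord i) (divord j)) else 0.
  have n0 : (0 < n)%N by case: n A i {j} => [A []|].
  have hm k : (k %% n < n)%N by rewrite ltn_mod.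
  rewrite (@tprod_entry _ _ _ _ _ _ _ _ _ (divord i) (Ordinal (hm i)) (divord j)
    (Ordinal (hm j))); [|exact: divn_eq|exact: divn_eq].
  by rewrite elemE mxE -val_eqE /=; case: eqP => _; rewrite ?mulr1 ?mulr0.
split; apply/matrixP => i j; rewrite elemE mxE.
  by rewrite H; case: ifP => // _; exact: elem_cplx0.
rewrite !mxE H eq_sym; case: ifP => _; first by rewrite elem_cplxJ.
by rewrite elem_cplx0 rmorph0.
Qed.

Lemma cvg_sumr (I : Type) (r : seq I) (f : I -> nat -> R) (l : I -> R) :
  (forall i, f i @ \oo --> l i) ->
  (fun k => \sum_(i <- r) f i k) @ \oo --> \sum_(i <- r) l i.
Proof. by move=> h; apply: cvg_big => [|i _];
  [exact: add_continuous|exact: h]. Qed.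

Lemma mx_cvg_conj d (s : nat -> 'M[C]_d) M (B : 'M[C]_d) : mx_cvg s M ->
  mx_cvg (fun k => B ^t* *m s k *m B) (B ^t* *m M *m B).
Proof.
move=> h i j.
have E (X : 'M[C]_d) : (B ^t* *m X *m B) i j =
    \sum_l \sum_k ((B ^t* i k * B l j) * X k l).
  rewrite mxE; apply: eq_bigr => l _; rewrite mxE mulr_suml.
  by apply: eq_bigr => k _; rewrite mulrAC.
have ReE (X : 'M[C]_d) : complex.Re ((B ^t* *m X *m B) i j) = \sum_l \sum_k
    (complex.Re (B ^t* i k * B l j) * complex.Re (X k l) -
     complex.Im (B ^t* i k * B l j) * complex.Im (X k l)).
  rewrite E Re_sum; apply: eq_bigr => l _; rewrite Re_sum.
  by apply: eq_bigr => k _; case: (_ * _) (X k l) => [u v] [u' v'].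
have ImE (X : 'M[C]_d) : complex.Im ((B ^t* *m X *m B) i j) = \sum_l \sum_k
    (complex.Re (B ^t* i k * B l j) * complex.Im (X k l) +
     complex.Im (B ^t* i k * B l j) * complex.Re (X k l)).
  rewrite E Im_sum; apply: eq_bigr => l _; rewrite Im_sum.
  by apply: eq_bigr => k _; case: (_ * _) (X k l) => [u v] [u' v'].
split.
  rewrite ReE; under eq_fun do rewrite ReE.
  apply: cvg_sumr => l; apply: cvg_sumr => k; have [h1 h2] := h k l.
  by apply: cvgB; apply: cvgM => //; exact: cvg_cst.
rewrite ImE; under eq_fun do rewrite ImE.
apply: cvg_sumr => l; apply: cvg_sumr => k; have [h1 h2] := h k l.
by apply: cvgD; apply: cvgM => //; exact: cvg_cst.
Qed.

(** The bound on the traces of the approximations passes to the limit. *)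
Lemma lower_computes_semi_density U a d q (M : 'M[C]_d) :
  lower_computes U a q M -> semi_density M.
Proof.
move=> [pM [s [_ sd _ cs]]]; split=> //; rewrite lecE; apply/andP; split.
  rewrite /mxtrace Im_sum big1 //= => i _.
  by have := psd_diag i pM; rewrite lecE => /andP[/eqP].
rewrite /mxtrace Re_sum /=.
have c : (fun k => \sum_i complex.Re (elem R (s k) i i)) @ \oo -->
    \sum_i complex.Re (M i i).
  by apply: cvg_sumr => i; have [] := cs i i.
rewrite -(cvg_lim (@Rhausdorff R) c); apply: limr_le; first by apply/cvg_ex;
  exists (\sum_i complex.Re (M i i)).
near=> k; have [_] := sd k; rewrite lecE => /andP[_].
by rewrite /mxtrace Re_sum.
Unshelve. all: by end_near.
Qed.

(** Unitary conjugation preserves trace, order and limits, so the rewritten approximations are again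
    increasing semi-density matrices. *)
Lemma lower_computes_conj U adj t n (A : 'M[rat[i]]_n) q (M : 'M[C]_(n * n)) :
  (forall (s : nat -> 'M[rat[i]]_(n * n)), outputs_seq U (enc_mx A) q s ->
     outputs_seq U (enc_mx A) (t ++ q) (fun k => conj_mx adj A (s k))) ->
  elem R (tensor_mx adj A) \is unitarymx ->
  lower_computes U (enc_mx A) q M ->
  lower_computes U (enc_mx A) (t ++ q)
    ((elem R (tensor_mx adj A)) ^t* *m M *m elem R (tensor_mx adj A)).
Proof.
set B := elem R _ => ht uB [pM [s [hs sd inc cs]]].
split; first exact: psd_conjmx.
exists (fun k => conj_mx adj A (s k)); split.
- exact: ht.
- move=> k; rewrite elem_conj_mx -/B; have [p1 p2] := sd k; split.
    exact: psd_conjmx.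
  by rewrite mxtrace_unitary_conj.
- move=> k; rewrite !elem_conj_mx -/B -mulmxBl -mulmxBr; exact: psd_conjmx.
- under eq_fun do rewrite elem_conj_mx.
  exact: mx_cvg_conj.
Qed.

End Elem.

(** * Tests and information *)

Section Info.
Variables (R : realType) (U : machine).
Hypothesis pU : prefix_machine U.
Variables (a : seq bool) (n : nat).
Local Notation N := (2 ^ n)%N.
Local Notation C := R[i].
Local Notation mu := (univ_semi_density R U a n).
Local Notation w := (fun M : 'M[C]_(N * N) =>
  fine (lower_prob U a M (enc_nat n))).

Lemma univ_prob_fin x y : univ_prob R U a x y \is a fin_num.
Proof.
by rewrite ge0_fin_numE ?univ_prob_ge0 // (le_lt_trans (univ_prob_le1 R pU a x
  y)) ?ltry.
Qed.

Lemma lower_prob_fin d (M : 'M[C]_d) y : lower_prob U a M y \is a fin_num.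
Proof.
by rewrite ge0_fin_numE ?lower_prob_ge0 // (le_lt_trans (lower_prob_le1 pU a M
  y)) ?ltry.
Qed.

Lemma lower_weight_ge0 M : 0 <= w M.
Proof. by rewrite fine_ge0 // lower_prob_ge0. Qed.

Lemma lower_weight_total (E : set 'M[C]_(N * N)) :
  (\esum_(M in E) (w M)%:E <= 1)%E.
Proof.
rewrite (eq_esum (b := fun M => lower_prob U a M (enc_nat n))).
  exact: lower_prob_total.
by move=> M _; rewrite fineK ?lower_prob_fin.
Qed.

(** A mixture of pure states; distinct states have distinct codes, so their weights sum to at most
    1. *)
Lemma univ_semi_density_semi : semi_density mu.
Proof.
apply: mixture_semi_density.
- by move=> phi; rewrite fine_ge0 // univ_prob_ge0.
- rewrite (eq_esum (b := fun phi => univ_prob R U a (enc_mx phi) (enc_nat n))).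
    rewrite -(esum_image (@elementary_states R n) (@enc_mx N 1)
      (fun x => univ_prob R U a x (enc_nat n))); first exact: univ_prob_total.
    move=> A B _ _ e; apply: (@enc_mx_cat_inj _ _ A B [::] [::]).
    by rewrite !cats0.
  by move=> phi _; rewrite fineK ?univ_prob_fin.
- move=> phi hphi; split; first exact: psd_rank1.
  by rewrite mxtrace_mulC hphi mxtrace1.
Qed.

Lemma psd_trace_ge0 d (M : 'M[C]_d) : psd M -> 0 <= \tr M.
Proof. by move=> pM; apply: sumr_ge0 => i _; exact: psd_diag. Qed.

Lemma semi_density_tprod d e (P : 'M[C]_d) (Q : 'M[C]_e) :
  semi_density P -> semi_density Q -> semi_density (tprod P Q).
Proof.
move=> [pP tP] [pQ tQ]; split; first exact: psd_tprod.
by rewrite mxtrace_prod mulr_ile1 ?psd_trace_ge0.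
Qed.

Lemma semi_density_trace_mul d (P Q : 'M[C]_d) :
  semi_density P -> semi_density Q -> 0 <= \tr (P *m Q) <= 1.
Proof.
move=> [pP tP] [pQ tQ]; have /andP[-> h] := psd_trace_mul pP pQ.
by rewrite (le_trans h) // mulr_ile1 ?psd_trace_ge0.
Qed.

(* The trace condition on tests is automatic, since lower computable matrices
   have trace at most 1. *)
Lemma testsP M : tests U a mu mu M <->
  (exists X Y, M = tprod X Y) /\ (exists q, lower_computes U a q M).
Proof.
split=> [[h1 h2 _]|[h1 h2]]; first by split.
split=> //; have [q /lower_computes_semi_density sM] := h2.
have sK := semi_density_tprod univ_semi_density_semi univ_semi_density_semi.
by have /andP[] := semi_density_trace_mul sM sK.
Qed.

(** The argument of the logarithm in [info], as a sum of nonnegative terms. *)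
Definition test_score (K : 'M[C]_(N * N)) : \bar R :=
  \esum_(M in tests U a mu mu) (w M * complex.Re (\tr (M *m K)))%:E.

Lemma tests_semi_density M : tests U a mu mu M -> semi_density M.
Proof. by move=> /testsP[_ [q]]; exact: lower_computes_semi_density. Qed.

Lemma test_score_term K M : tests U a mu mu M -> semi_density K ->
  0 <= complex.Re (\tr (M *m K)) <= 1.
Proof.
move=> /tests_semi_density sM sK.
by have := semi_density_trace_mul sM sK; rewrite !lecE =>
  /andP[/andP[_ ->] /andP[_ ->]].
Qed.

Lemma test_score_ge0 K : semi_density K -> (0 <= test_score K)%E.
Proof.
move=> sK; apply: esum_ge0 => M hM;
  rewrite lee_fin mulr_ge0 ?lower_weight_ge0 //.
by have /andP[] := test_score_term hM sK.
Qed.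

Lemma test_score_fin K : semi_density K -> test_score K \is a fin_num.
Proof.
move=> sK; rewrite ge0_fin_numE ?test_score_ge0 //.
apply: (@le_lt_trans _ _ 1%E); last exact: ltry.
apply: le_trans (lower_weight_total (tests U a mu mu)).
apply: le_esum => M hM; rewrite lee_fin ler_piMr ?lower_weight_ge0 //.
by have /andP[] := test_score_term hM sK.
Qed.

Lemma infoE sigma rho : semi_density sigma -> semi_density rho ->
  info U a sigma rho = log2 (test_score (tprod sigma rho)).
Proof.
move=> ss sr; have sK := semi_density_tprod ss sr.
rewrite /info /univ_test (mixture_trace_psd _ _ _ sK.1).
- by rewrite /= fineK ?test_score_fin.
- exact: lower_weight_ge0.
- exact: lower_weight_total.
- exact: tests_semi_density.
Qed.

(** The term of [M] on the left has the same trace factor as the term of [f M] on the right, and its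
    weight is at most [2 ^+ size r] times larger. As [f] is injective, the right-hand terms met in
    this way sum to at most the whole score. *)
Lemma test_score_transfer (E : 'M[C]_N) (K : 'M[C]_(N * N)) (t r : seq bool) :
  E \is unitarymx -> semi_density K ->
  (forall q (M : 'M[C]_(N * N)), lower_computes U a q M ->
     lower_computes U a (t ++ q) ((tprod E 1%:M) ^t* *m M *m tprod E 1%:M)) ->
  (forall y p x, computes U a y p x -> computes U a y (r ++ p) (t ++ x)) ->
  (test_score (tprod E 1%:M *m K *m (tprod E 1%:M) ^t*) <=
   ((2 : R) ^+ size r)%:E * test_score K)%E.
Proof.
set B := tprod E 1%:M => uE sK hM hr.
have BE : B ^t* = tprod (E ^t*) 1%:M by rewrite tprod_trmxC trmx1 map_mx1.
have uB : B \is unitarymx.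
  apply/unitarymxP; rewrite BE -tprodE (unitarymxP uE) mulmx1; exact: tprod1.
have uB' : B ^t* *m B = 1%:M by exact/mulmx1C/unitarymxP.
pose f M := B ^t* *m M *m B.
have ft M : tests U a mu mu M -> tests U a mu mu (f M).
  move=> /testsP[[X [Y ->]] [q hq]]; apply/testsP; split.
    (* Only the first tensor factor is rotated, so the image is again a tensor product. *)
    by exists (E ^t* *m X *m E), Y; rewrite /f BE -!tprodE mul1mx mulmx1.
  by exists (t ++ q); exact: hM.
have fw M : w M <= 2 ^+ size r * w (f M).
  have := lower_prob_transfer (y := enc_nat n) (hM^~ M) (hr (enc_nat n)).
  rewrite -(fineK (lower_prob_fin M _)) -(fineK (lower_prob_fin (f M) _))
    -EFinM lee_fin.
  by rewrite exprVn mulrC ler_pdivrMr ?exprn_gt0 // mulrC.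
have fK M : \tr (M *m (B *m K *m B ^t*)) = \tr (f M *m K).
  by rewrite /f !mulmxA mxtrace_mulC !mulmxA.
have fin : set_inj (tests U a mu mu) f.
  move=> M M' _ _ /(congr1 (fun X => B *m X *m B ^t*)).
  by rewrite /f !mulmxA (unitarymxP uB) !mul1mx -!mulmxA (unitarymxP uB)
    !mulmx1.
(* The absolute value below makes the terms nonnegative at every matrix, as [esumZl] requires; on
   tests it changes nothing. *)
pose tau M := complex.Re (\tr (M *m K)).
apply: (@le_trans _ _ (\esum_(M in tests U a mu mu)
   (((2 : R) ^+ size r)%:E * (w (f M) * `|tau (f M)|)%:E))%E).
  apply: le_esum => M hT; rewrite -EFinM lee_fin fK mulrA -/(tau _).
  have /andP[h0 _] := test_score_term (ft M hT) sK.
  by rewrite ger0_norm //; apply: ler_wpM2r.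
have tau0 M : (0 <= (w M * `|tau M|)%:E)%E.
  by rewrite lee_fin mulr_ge0 ?lower_weight_ge0.
rewrite esumZl ?exprn_ge0 //; apply: lee_wpmul2l;
  first by rewrite lee_fin exprn_ge0.
rewrite -(esum_image _ f (fun M => (w M * `|tau M|)%:E)) //.
apply: (@le_trans _ _ (\esum_(M in tests U a mu mu) (w M * `|tau M|)%:E)).
  by apply: esum_subset => _ [M hT <-]; exact: ft.
apply: le_esum => M hT; rewrite lee_fin ger0_norm //.
by have /andP[] := test_score_term hT sK.
Qed.

End Info.

(** For [x = 0] the left side is [-oo]; otherwise [y] is positive as well and the logarithms are
    real. *)
Lemma log2_le_add (R : realType) (x y : \bar R) (k : nat) :
  x \is a fin_num -> y \is a fin_num -> (0 <= x)%E -> (0 <= y)%E ->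
  (x <= ((2 : R) ^+ k)%:E * y)%E -> (log2 x <= log2 y + k%:R%:E)%E.
Proof.
move=> /fineK <- /fineK <-; move: (fine x) (fine y) => {}x {}y.
rewrite -EFinM !lee_fin => x0 y0 xy.
have l2 : 0 < ln 2 :> R by rewrite ln_gt0 ?ltr1n.
move: x0; rewrite le_eqVlt => /predU1P[<-|x0].
  rewrite /log2 le0_lneNy // mulNyr gtr0_sg ?invr_gt0 // mul1e.
  exact: leNye.
have y1 : 0 < y.
  have := lt_le_trans x0 xy; by rewrite pmulr_rgt0 ?exprn_gt0.
rewrite /log2 !lne_EFin // -!EFinM -EFinD lee_fin.
rewrite ler_pdivrMr // mulrDl mulfVK ?gt_eqF //.
have := xy; rewrite -ler_ln ?posrE ?mulr_gt0 ?exprn_gt0 //.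
by rewrite lnM ?posrE ?exprn_gt0 // lnXn // addrC mulr_natl.
Qed.

Theorem theorem5 (R : realType) (U : machine)
    (hU : universal_prefix_machine U) :
  exists c : R,
    forall (n : nat) (A : 'M[rat[i]]_(2 ^ n)%N) (sigma rho : 'M[R[i]]_(2 ^ n)%N),
      elem R A \is unitarymx -> semi_density sigma -> semi_density rho ->
      let sigmaA := elem R A *m sigma *m ((elem R A) ^t*)%sesqui in
      (info U (enc_mx A) sigmaA rho <= info U (enc_mx A) sigma rho + c%:E)%E /\
      (info U (enc_mx A) sigma rho <= info U (enc_mx A) sigmaA rho + c%:E)%E.
Proof.
have pU := hU.1.
have [t0 ht0] := conj_machine hU false; have [r0 hr0] :=
  universal_output_prefix t0 hU.
have [t1 ht1] := conj_machine hU true; have [r1 hr1] :=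
  universal_output_prefix t1 hU.
(* Each direction costs the length of one of the two words; the sum covers both. *)
exists (size r0 + size r1)%:R => n A sigma rho uA ss sr sigmaA.
set E := elem R A in uA sigmaA *; set a := enc_mx A.
have n0 : (0 < 2 ^ n)%N by rewrite expn_gt0.
have uE : E ^t* \is unitarymx by rewrite trmxC_unitary.
have EE : E ^t* *m E = 1%:M by have := mulmxKtV 1%:M uA erefl; rewrite mul1mx.
have ssA : semi_density sigmaA.
  have [pS tS] := ss; have := psd_conjmx (E ^t*) pS; rewrite trmxCK; split=> //.
  by rewrite /sigmaA mxtrace_mulC mulmxA EE mul1mx.
have [T0 T1] := elem_tensor_mx R A; rewrite -/E in T0 T1.
have BE (X : 'M[R[i]]_(2 ^ n)%N) : (tprod X (1%:M : 'M[R[i]]_(2 ^ n)%N)) ^t* =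
  tprod (X ^t*) 1%:M.
  by rewrite tprod_trmxC trmx1 map_mx1.
rewrite BE in T1.
have uT (X : 'M[R[i]]_(2 ^ n)%N) : X \is unitarymx ->
  tprod X (1%:M : 'M[R[i]]_(2 ^ n)%N) \is unitarymx.
  move=> uX; apply/unitarymxP; rewrite BE -tprodE (unitarymxP uX) mulmx1;
    exact: tprod1.
have KE (X s : 'M[R[i]]_(2 ^ n)%N) : tprod X 1%:M *m tprod s rho *m (tprod X
  1%:M) ^t* =
    tprod (X *m s *m X ^t*) rho.
  by rewrite BE -!tprodE mul1mx mulmx1.
have sK s : semi_density s -> semi_density (tprod s rho).
  by move=> h; exact: semi_density_tprod.
have bound (k : nat) (x : \bar R) : (k <= size r0 + size r1)%N ->
    (x + k%:R%:E <= x + (size r0 + size r1)%:R%:E)%E.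
  by move=> h; apply: leeD2l; rewrite lee_fin ler_nat.
have fin s : semi_density s -> test_score U a (tprod s rho) \is a fin_num.
  by move=> h; exact/test_score_fin/sK.
have ge0 s : semi_density s -> (0 <= test_score U a (tprod s rho))%E.
  by move=> h; exact/test_score_ge0/sK.
rewrite !infoE //; split.
- apply: le_trans (bound (size r0) _ (leq_addr _ _)).
  apply: log2_le_add; rewrite ?fin ?ge0 // /sigmaA -KE.
  apply: (test_score_transfer pU (t := t0)) => //; first exact: sK.
    move=> q M hq; rewrite -T0; apply: lower_computes_conj hq;
      last by rewrite T0 uT.
    by move=> s; exact: ht0.
  by move=> y p x; exact: hr0.
- apply: le_trans (bound (size r1) _ (leq_addl _ _)).
  apply: log2_le_add; rewrite ?fin ?ge0 //.
  (* The second inequality is the first with the adjoint unitary, applied to the rotated state. *)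
  have -> : sigma = E ^t* *m sigmaA *m (E ^t*) ^t*.
    by rewrite trmxCK /sigmaA !mulmxA EE mul1mx -mulmxA EE mulmx1.
  rewrite -KE; apply: (test_score_transfer pU (t := t1)) => //; first exact: sK.
    move=> q M hq; rewrite -T1; apply: lower_computes_conj hq;
      last by rewrite T1 uT.
    by move=> s; exact: ht1.
  by move=> y p x; exact: hr1.
Qed.
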